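(* Let $M$ be a prime and let $q$ be a power of $M$. Then, as formal power series in $u$, $$1+\sum_{n=1}^{\infty}\frac{|\mathrm{GL}(n,q)^M|}{|\mathrm{GL}(n,q)|}u^n=\prod_{f\in\Phi}\left(1+\sum_{n\geq 1}\ \sum_{\substack{\lambda\vdash n\\ \lambda\in\Theta_M(\Lambda(n))}}\frac{u^{n\deg(f)}}{q^{\deg(f)\sum_i(\lambda'_i)^2}\prod_{i\geq 1}\left(\frac{1}{q^{\deg(f)}}\right)_{m_i(\lambda)}}\right).$$
   Context: $\mathrm{GL}(n,q)$ is the group of invertible $n\times n$ matrices over the field $\mathbb F_q$ with $q$ elements, and $\mathrm{GL}(n,q)^M=\{x^M\mid x\in\mathrm{GL}(n,q)\}$. $\Phi$ is the set of monic irreducible polynomials of degree $\geq 1$ over $\mathbb F_q$ other than $x$. For a partition $\lambda$, $\lambda'=(\lambda'_1,\lambda'_2,\dots)$ is the transpose partition and $m_i(\lambda)$ is the number of parts of $\lambda$ equal to $i$. The notation $\left(\frac{1}{q^{d}}\right)_m$ means $\prod_{k=1}^m\left(1-\frac{1}{q^{dk}}\right)$. $\Lambda(n)$ is the set of partitions of $n$. The map $\Theta_M:\Lambda(n)\to\Lambda(n)$ sends $\lambda=(\lambda_1,\dots,\lambda_k)$ to the partition obtained by replacing each part $\lambda_i$ by $\bar\lambda_i$ copies of $\lceil\lambda_i/M\rceil$ and $M-\bar\lambda_i$ copies of $\lfloor\lambda_i/M\rfloor$, where $0\leq\bar\lambda_i\leq M-1$ is the residue of $\lambda_i$ modulo $M$,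 then discarding zeros and rearranging in non-increasing order. *)

(* Defs.v *)
From mathcomp Require Import all_boot all_order all_algebra all_fingroup.

Set Implicit Arguments.
Unset Strict Implicit.
Unset Printing Implicit Defensive.

Import Order.TTheory GRing.Theory Num.Theory.
Local Open Scope ring_scope.

(** ** Formal power series over [rat], given by their coefficients *)

Definition fps : Type := nat -> rat.

Definition fps_one : fps := fun n => (n == 0%N)%:R.

Definition fps_mul (a b : fps) : fps :=
  fun n => \sum_(i < n.+1) a i * b (n - i)%N.

(** [is_fps_prod P G L]: the unordered infinite product of the [G i], for [i]
    satisfying [P], converges to [L] in the u-adic topology, i.e. each
    coefficient of the finite partial products is eventually that of [L]. *)
Definition is_fps_prod (I : eqType) (P : I -> Prop) (G : I -> fps) (L : fps) :
    Prop :=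
  forall n : nat, exists2 s0 : seq I, (forall i, i \in s0 -> P i) &
    forall s : seq I, uniq s -> (forall i, i \in s -> P i) ->
      {subset s0 <= s} -> (\big[fps_mul/fps_one]_(i <- s) G i) n = L n.

(** ** Integer partitions, as non-increasing sequences of positive parts *)

Definition is_partition (n : nat) (s : seq nat) : bool :=
  [&& sorted geq s, 0%N \notin s & sumn s == n].

(** A partition of [n] has at most [n] parts, each at most [n]; see
    [mem_partitions] and [uniq_partitions]. *)
Definition partitions (n : nat) : seq (seq nat) :=
  [seq s <- [seq map val (val t) | t <- enum {: n.-bseq 'I_n.+1}]
     | is_partition n s].

Lemma uniq_partitions n : uniq (partitions n).
Proof.
rewrite filter_uniq // map_inj_uniq ?enum_uniq //.
by move=> t1 t2 /(inj_map val_inj) /val_inj.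
Qed.

Lemma mem_partitions n s : (s \in partitions n) = is_partition n s.
Proof.
rewrite mem_filter andb_idr // => /and3P[_ s_gt0 /eqP s_sum].
have size_s : (size s <= n)%N.
  rewrite -s_sum; elim: s s_gt0 {s_sum} => //= p s IHs.
  rewrite inE negb_or eq_sym -lt0n => /andP[p_gt0 /IHs].
  by rewrite -add1n; apply: leq_add.
have le_s p : p \in s -> (p < n.+1)%N.
  rewrite ltnS -s_sum; elim: s {s_gt0 s_sum size_s} => //= r s IHs.
  rewrite inE => /orP[/eqP-> | /IHs le_ps]; first exact: leq_addr.
  exact: leq_trans le_ps (leq_addl _ _).
have size_t : (size [seq inord p : 'I_n.+1 | p <- s] <= n)%N.
  by rewrite size_map.
apply/mapP; exists (Bseq size_t); first by rewrite mem_enum.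
rewrite /= -map_comp -[LHS]map_id; apply/eq_in_map => p /le_s lt_p /=.
by rewrite inordK.
Qed.

(** The parts of the transpose partition: its i-th part (i >= 1) is the number
    of parts of [s] that are at least [i]. *)
Definition transpose (s : seq nat) : seq nat :=
  [seq count (leq i) s | i <- iota 1 (\max_(p <- s) p)].

Definition ceil_div (a m : nat) : nat := ((a + m.-1) %/ m)%N.

Definition Theta (M : nat) (s : seq nat) : seq nat :=
  sort geq [seq p <- flatten [seq nseq (a %% M)%N (ceil_div a M)
                                   ++ nseq (M - a %% M)%N (a %/ M)%N | a <- s]
              | (0 < p)%N].

(** ** The two sides of the identity *)

Definition deg (F : finFieldType) (f : {poly F}) : nat := (size f).-1.

(** [irreducible_poly f] already implies that [f] is not constant. *)
Definition Phi (F : finFieldType) (f : {poly F}) : Prop :=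
  [/\ f \is monic, irreducible_poly f & f != 'X].

(** [(1 / q ^ d)_m]. *)
Definition qpoch (q d m : nat) : rat :=
  \prod_(1 <= k < m.+1) (1 - 1 / q%:R ^+ (d * k)).

(** The coefficient of [u ^ (n * d)] contributed by the partition [s] of [n];
    in the product, the factors with [i > n] are 1 since all parts are at most
    [n]. *)
Definition partition_weight (q d n : nat) (s : seq nat) : rat :=
  1 / (q%:R ^+ (d * \sum_(p <- transpose s) p ^ 2)
       * \prod_(1 <= i < n.+1) qpoch q d (count_mem i s)).

(** [1 + \sum_(n >= 1) c n * u ^ (n * d)], where [c n] is the sum of the weights
    of the partitions of [n] in the image of [Theta M]; as [d] is positive, only
    indices [n <= N] contribute to the coefficient of [u ^ N]. *)
Definition local_factor (M q d : nat) : fps :=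
  fun N => fps_one N +
    \sum_(1 <= n < N.+1 | (n * d == N)%N)
      \sum_(s <- partitions n | s \in [seq Theta M t | t <- partitions n])
        partition_weight q d n s.

Definition GL_powers (F : finFieldType) (n M : nat) : {set {'GL_n[F]}} :=
  [set (x ^+ M)%g | x in 'GL_n[F]%g].

(** ['GL_n[F]] is a group of matrices of size [n.-1.+1], whence the separate
    case of the constant coefficient. *)
Definition GL_power_series (F : finFieldType) (M : nat) : fps :=
  fun n => if n == 0%N then 1 else #|GL_powers F n M|%:R / #|'GL_n[F]%g|%:R.

(* Main.v *)
Require Import Defs.
From mathcomp Require Import all_boot all_order all_algebra all_fingroup all_field.
From mathcomp Require Import zify ring.

Set Implicit Arguments.
Unset Strict Implicit.
Unset Printing Implicit Defensive.

Import Order.TTheory GRing.Theory Num.Theory.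
Local Open Scope ring_scope.

(** Let [q] be the number of elements of [F]. Weight each matrix of size [n] by
    the inverse of the number of units. For coprime [p] and [r], the matrices
    killed by [p * r] are the conjugates of block diagonal matrices with one
    block killed by [p] and one killed by [r], and they are [M]-th powers if and
    only if both blocks are, since a root commutes with its power. Double
    counting of conjugations ([orbit_count]) turns this into a Cauchy product of
    weighted numbers ([power_mass_coprime]). By Cayley-Hamilton, every
    invertible matrix of size [n] is killed by a power of the product of the
    irreducible polynomials other than ['X] of degree at most [n]; so the
    generating function of the weighted numbers of [M]-th powers is the product
    over [f] of those for matrices killed by a power of [f].

    Fix [f], of degree [d], with residue field [K]. Since [M] is the
    characteristic, Jordan decompositions are explicit: the semisimple part of
    [x] is [x ^+ N] for a suitable power [N] of [q]. Semisimple parts, being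
    roots of [f], are all conjugate, and the centralizer of one is a matrix
    algebra over [K]; each has an [M]-th root among its powers because the
    Frobenius map of [K] is onto. The [M]-th power is additive on commuting
    matrices, so [x] is an [M]-th power if and only if its nilpotent part is
    that of a nilpotent matrix over [K] ([card_powers_primary]). This leaves
    nilpotent matrices over the finite field [K], which has [q ^ d] elements.

    The type of a nilpotent matrix is the partition given by the ranks of its
    powers. Taking an [M]-th power subsamples these ranks, which is what [Theta
    M] does to the partition ([ranksum_Theta]). The type determines the
    conjugacy class ([has_type_conj]) and every type occurs, so the [M]-th
    powers are the matrices with a type in the image of [Theta M]
    ([nil_powersP]). The weighted number of matrices of a given type is found by
    removing the columns of its Young diagram one at a time, that is, by taking
    quotients by kernels ([card_type_set]); it is the coefficient in the local
    factor. *)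

(** * Counting matrices up to conjugation *)

(** Unlike ['GL_n], whose elements are matrices of size [n.-1.+1], the units
    counted here also have the right number, one, in size 0. *)
Definition gl (F : finFieldType) n := #|[set A : 'M[F]_n | A \in unitmx]|.

Definition sim (F : fieldType) n (g x : 'M[F]_n) : 'M[F]_n :=
  g *m x *m invmx g.

Section Similarity.
Variables (F : fieldType) (n : nat).
Implicit Types g h x y : 'M[F]_n.

Lemma simP g x y : g \in unitmx -> reflect (g *m x = y *m g) (sim g x == y).
Proof.
move=> gU; apply: (iffP eqP) => [<- | e]; first by rewrite mulmxKV.
by rewrite /sim e mulmxK.
Qed.

Lemma simM g h x : g \in unitmx -> h \in unitmx ->
  sim (g *m h) x = sim g (sim h x).
Proof.
move=> gU hU; apply/eqP/simP; first by rewrite unitmx_mul gU.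
by rewrite /sim !mulmxA !mulmxKV.
Qed.

Lemma sim1 x : sim 1%:M x = x.
Proof. by rewrite /sim invmx1 mulmx1 mul1mx. Qed.

Lemma simK g : g \in unitmx -> cancel (sim g) (sim (invmx g)).
Proof.
by move=> gU x; rewrite -simM ?unitmx_inv // mulVmx // sim1.
Qed.

Lemma simVK g : g \in unitmx -> cancel (sim (invmx g)) (sim g).
Proof.
by move=> gU x; rewrite -simM ?unitmx_inv // mulmxV // sim1.
Qed.

Lemma simX g x i : g \in unitmx -> sim g (x ^+ i) = sim g x ^+ i.
Proof.
move=> gU; elim: i => [|i IHi].
  by rewrite !expr0 /sim mulmx1 mulmxV.
by rewrite !exprS -IHi /sim -mulmxE !mulmxA mulmxKV.
Qed.

Lemma rank_sim g x : g \in unitmx -> \rank (sim g x) = \rank x.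
Proof.
move=> gU; rewrite mxrankMfree ?row_free_unit ?unitmx_inv //.
by rewrite eqmxMfull // row_full_unit.
Qed.

End Similarity.

(** Count the pairs of an [x] in [X] and a unit [g] that conjugates [x] into [Y].
    Each [g] occurs with one [x] for each element of [Y]; the [g] that occur with
    a given [x] form a coset of [H]. *)
Lemma orbit_count (F : finFieldType) n (X Y H : {set 'M[F]_n}) :
    {in H, forall h, h \in unitmx} ->
    (forall g y, g \in unitmx -> y \in Y -> sim g y \in X) ->
    (forall x, x \in X -> exists2 g, g \in unitmx & sim g x \in Y) ->
    (forall h y, h \in unitmx -> y \in Y -> (sim h y \in Y) = (h \in H)) ->
  (#|X| * #|H| = gl F n * #|Y|)%N.
Proof.
move=> HU YX XY YH; pose U := [set g : 'M[F]_n | g \in unitmx].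
transitivity (\sum_(x in X) \sum_(g in U | sim g x \in Y) 1)%N.
  rewrite -sum_nat_const; apply: eq_bigr => x /XY[g gU Yg].
  rewrite sum1dep_card -(card_imset (mem H) (can_inj (mulmxK gU))).
  apply: eq_card => h; rewrite [RHS]inE /U inE; apply/imsetP/andP => [[k Hk ->] | [hU Yh]].
    have kU := HU _ Hk.
    by rewrite unitmx_mul kU gU simM // YH.
  exists (h *m invmx g); last by rewrite mulmxKV.
  have hgU : h *m invmx g \in unitmx by rewrite unitmx_mul hU unitmx_inv.
  by rewrite -(YH _ _ hgU Yg) -simM // mulmxKV.
rewrite (exchange_big_dep (mem U)) /= => [|x g _ /andP[]//].
rewrite /gl -sum_nat_const; apply: eq_bigr => g; rewrite inE => gU.
rewrite sum1dep_card -(card_imset (mem Y) (can_inj (simVK gU))).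
apply: eq_card => x; rewrite inE; apply/andP/imsetP => [[Xx /andP[_ Yx]] | [y Yy ->]].
  by exists (sim g x); rewrite // simK.
by rewrite simVK // YX ?unitmx_inv // gU.
Qed.

(** * Counting row-free matrices *)

Section RowFree.
Variable F : finFieldType.
Implicit Types (k a b : nat).

Definition row_free_set k a := [set N : 'M[F]_(k, a) | row_free N].

Lemma row_free_col_mx k a (u : 'rV[F]_a) (N : 'M[F]_(k, a)) :
  row_free (col_mx u N) = row_free N && ~~ (u <= N)%MS.
Proof.
apply/idP/andP => [uN | [rN uN]].
  have nul (w : 'rV_1) (v : 'rV_k) : w *m u + v *m N = 0 -> row_mx w v = 0.
    move=> e; apply/eqP; rewrite -(mulmx_free_eq0 _ uN) mul_row_col.
    by apply/eqP.
  split.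
    apply: inj_row_free => v vN.
    have := nul 0 v; rewrite mul0mx add0r => /(_ vN)/eqP.
    by rewrite row_mx_eq0 => /andP[_ /eqP].
  apply/submxP => -[v uE].
  have := nul (-1)%:M v; rewrite mul_scalar_mx uE scaleN1r addNr.
  move=> /(_ erefl)/eqP; rewrite row_mx_eq0 => /andP[/eqP/matrixP/(_ 0 0)].
  by rewrite !mxE mulr1n => /eqP; rewrite oppr_eq0 oner_eq0.
apply: inj_row_free => v; rewrite -[v]hsubmxK mul_row_col.
move: (lsubmx v) (rsubmx v) => w z e; rewrite [w]mx11_scalar in e *.
move: e; set c := w 0 0; rewrite mul_scalar_mx.
have [-> /eqP | c0 e] := eqVneq c 0.
  by rewrite scale0r add0r mulmx_free_eq0 // => /eqP ->; rewrite raddf0 row_mx0.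
case/submxP: uN; exists (- c^-1 *: z); rewrite -scalemxAl.
have -> : z *m N = - (c *: u) by apply/eqP; rewrite -addr_eq0 addrC e.
by rewrite scalerN scaleNr opprK scalerA mulVf // scale1r.
Qed.

Lemma card_submx_row_free k a (N : 'M[F]_(k, a)) : row_free N ->
  #|[set u : 'rV_a | (u <= N)%MS]| = (#|F| ^ k)%N.
Proof.
move=> rN; transitivity #|[set v *m N | v : 'rV[F]_k]|.
  apply: eq_card => u; rewrite inE.
  by apply/submxP/imsetP => [[v ->] | [v _ ->]]; exists v.
by rewrite card_imset ?card_mx ?mul1n //; apply: row_free_inj.
Qed.

(** Rows are chosen one at a time: given [i] independent rows, the next one must
    avoid their span, which has [#|F| ^ i] elements. *)
Lemma card_row_free_set k a :
  (#|row_free_set k a|%:R : rat)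
    = \prod_(0 <= i < k) (#|F|%:R ^+ a - #|F|%:R ^+ i).
Proof.
elim: k => [|k IHk].
  rewrite big_geq // (_ : row_free_set 0 a = setT) ?cardsT ?card_mx ?mul0n //.
  by apply/setP => N; rewrite !inE /row_free flatmx0 mxrank0.
rewrite big_nat_recr //= -IHk.
have -> : #|row_free_set k.+1 a|
          = (\sum_(N in row_free_set k a) #|[set u : 'rV_a | ~~ (u <= N)%MS]|)%N.
  rewrite -sum1_card (partition_big (@dsubmx _ 1 k a) (mem (row_free_set k a))).
    apply: eq_bigr => N; rewrite !inE => rN; rewrite sum1dep_card.
    rewrite -(card_imset [set u | ~~ (u <= N)%MS] (can_inj (fun u => col_mxKu u N))).
    apply: eq_card => A; rewrite [LHS]inE /row_free_set inE; apply/andP/imsetP.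
      case=> rA /eqP dA; exists (usubmx (A : 'M_(1 + k, a))).
        by move: rA; rewrite -[A]vsubmxK row_free_col_mx dA inE col_mxKu => /andP[].
      by rewrite -dA vsubmxK.
    by case=> u; rewrite inE => uN ->; rewrite col_mxKd row_free_col_mx rN.
  move=> A; rewrite !inE -{1}[A](@vsubmxK _ 1 k) row_free_col_mx.
  by case/andP.
rewrite natr_sum (eq_bigr (fun=> #|F|%:R ^+ a - #|F|%:R ^+ k)) => [|N].
  by rewrite sumr_const mulr_natl.
rewrite inE => /card_submx_row_free cN; rewrite -!natrX -cN.
have := cardsC [set u : 'rV[F]_a | (u <= N)%MS]; rewrite card_mx mul1n => <-.
rewrite natrD addrAC subrr add0r; congr _%:R; apply: eq_card => u.
by rewrite !inE.
Qed.

Lemma gl_row_free n : gl F n = #|row_free_set n n|.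
Proof. by apply: eq_card => A; rewrite !inE row_free_unit. Qed.

Lemma gl_gt0 n : (0 < gl F n)%N.
Proof. by apply/card_gt0P; exists 1%:M; rewrite inE unitmx1. Qed.

(** Multiplication by a row-free [N] on the left is a surjective linear map, all
    the fibres of which have the same size. *)
Lemma card_preim_mulmx k b a (N : 'M[F]_(k, b)) (S : {set 'M[F]_(k, a)}) :
    row_free N ->
  (#|[set C : 'M[F]_(b, a) | N *m C \in S]| * #|F| ^ (k * a)
   = #|S| * #|F| ^ (b * a))%N.
Proof.
move=> rN.
(* Both sides count the pairs of matrices [C], [D] with [N *m C + D] in [S]. *)
transitivity
  (\sum_(D : 'M[F]_(k, a)) \sum_(C : 'M[F]_(b, a) | (N *m C + D)%R \in S) 1)%N.
  rewrite -card_mx mulnC -sum_nat_const.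
  apply: eq_big => // D _; rewrite sum1dep_card.
  pose f (C : 'M[F]_(b, a)) := C - pinvmx N *m D.
  have fi : injective f by apply: addIr.
  rewrite -(card_imset _ fi); apply: eq_card => C; rewrite [RHS]inE.
  apply/imsetP/idP => [[C' C'S ->] | CS].
    by move: C'S; rewrite inE /f mulmxBr mulmxA mulmxVp // mul1mx subrK.
  exists (C + pinvmx N *m D); last by rewrite /f addrK.
  by rewrite inE mulmxDr mulmxA mulmxVp // mul1mx.
rewrite (exchange_big_dep xpredT) //= mulnC -card_mx -sum_nat_const.
apply: eq_big => // C _; rewrite sum1dep_card.
rewrite -(card_imset (mem S) (addrI (- (N *m C)))); apply: eq_card => D.
rewrite inE; apply/idP/imsetP => [DS | [D' D'S ->]].
  by exists (N *m C + D) => //; rewrite addKr.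
by rewrite addrA subrr add0r.
Qed.

End RowFree.

(** * Partitions and their truncated sums *)

(** The rank of the [i]-th power of a nilpotent matrix with Jordan blocks of
    sizes [s]: such a power of a block of size [p] has rank [p - i], truncated. *)
Definition ranksum (s : seq nat) i := (\sum_(p <- s) (p - i))%N.

Lemma partition_part_le n s p : is_partition n s -> p \in s -> (p <= n)%N.
Proof.
case/and3P=> _ _ /eqP <-; elim: s => //= r s IHs.
rewrite inE => /orP[/eqP-> | /IHs le_ps]; first exact: leq_addr.
exact: leq_trans le_ps (leq_addl _ _).
Qed.

Lemma ranksum0 s : ranksum s 0 = sumn s.
Proof. by rewrite /ranksum sumnE; apply: eq_bigr => p _; rewrite subn0. Qed.

Lemma ranksum_eq0 n s i : is_partition n s -> (n <= i)%N -> ranksum s i = 0%N.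
Proof.
move=> sn ni; rewrite /ranksum big_seq big1 // => p /(partition_part_le sn) pn.
by apply/eqP; rewrite subn_eq0 (leq_trans pn).
Qed.

Lemma ranksum_count s i :
  ranksum s i = (ranksum s i.+1 + count (fun p => i < p)%N s)%N.
Proof.
rewrite /ranksum; elim: s => [|p s IHs]; first by rewrite !big_nil.
by rewrite !big_cons IHs /=; lia.
Qed.

(** The first differences of [ranksum s] count the parts larger than a bound, so
    the second ones are the multiplicities of the parts. *)
Lemma partition_inj n m s t : is_partition n s -> is_partition m t ->
  (forall i, ranksum s i = ranksum t i) -> s = t.
Proof.
case/and3P=> ss s0 _ /and3P[tt t0 _] st.
have cst i : count (fun p => i < p)%N s = count (fun p => i < p)%N t.
  by have := st i; rewrite (ranksum_count s) (ranksum_count t) st => /addnI.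
have count1 (r : seq nat) i :
    (count_mem i.+1 r + count (fun p => i.+1 < p)%N r = count (fun p => i < p)%N r)%N.
  by elim: r => //= p r <-; lia.
apply: (sorted_eq _ _ ss tt).
- by move=> y x z yx zy; apply: leq_trans zy yx.
- by move=> x y xy; apply/eqP; rewrite eqn_leq andbC.
apply/allP => i _; apply/eqP; case: i => [|i].
  by rewrite (count_memPn s0) (count_memPn t0).
by have := etrans (count1 s i) (etrans (cst i) (esym (count1 t i))); rewrite cst => /addIn.
Qed.

(** The partition whose Young diagram is that of [t] with a first column of
    height [a] added. *)
Definition add_column a (t : seq nat) := map S t ++ nseq (a - size t) 1%N.

Lemma sumn_add_column a t : (size t <= a)%N ->
  sumn (add_column a t) = (sumn t + a)%N.
Proof.
move=> ta; rewrite sumn_cat sumn_nseq mul1n.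
have -> : sumn (map S t) = (sumn t + size t)%N by elim: t {ta} => //= p t ->; lia.
by lia.
Qed.

Lemma ranksum_add_column a t i : ranksum (add_column a t) i.+1 = ranksum t i.
Proof.
rewrite /ranksum big_cat big_map /= [X in (_ + X)%N]big_nseq_cond /=.
rewrite [X in (_ + X)%N](_ : _ = 0)%N ?addn0.
  by apply: eq_bigr => p _; rewrite subSS.
by elim: (_ - _)%N => //= m ->; rewrite subSS sub0n.
Qed.

Lemma add_column_partition b a t : is_partition b t -> (size t <= a)%N ->
  is_partition (b + a) (add_column a t).
Proof.
case/and3P=> st t0 /eqP bt ta; apply/and3P; split.
- have trg : transitive geq by move=> y x z yx zy; apply: leq_trans zy yx.
  rewrite sorted_pairwise // /add_column pairwise_cat; apply/and3P; split.
  + apply/allrelP => x y /mapP[p _ ->] /nseqP[-> _] //.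
  + rewrite -sorted_pairwise // (homo_sorted _ _ st) // => x y; exact: leq_ltn_trans.
  + by rewrite -sorted_pairwise //; elim: (_ - _)%N => //= -[|m].
- rewrite mem_cat negb_or mem_nseq andbF andbT.
  by apply/mapP => -[].
by rewrite sumn_add_column // bt.
Qed.

Lemma partition_add_column n s : is_partition n s ->
  exists t, [/\ s = add_column (size s) t, (size s <= n)%N,
                (size t <= size s)%N & is_partition (n - size s) t].
Proof.
case/and3P=> ss s0 /eqP <-; pose t := [seq p.-1 | p <- s & (1 < p)%N].
have trg : transitive geq by move=> y x z yx zy; apply: leq_trans zy yx.
have ts : (size t <= size s)%N by rewrite size_map size_filter count_size.
have e : s = add_column (size s) t.
  rewrite /add_column /t size_map size_filter -map_comp.
  elim: s ss s0 {t ts} => //= p s IHs ps; rewrite inE negb_or eq_sym -lt0n.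
  case/andP=> p0 /(IHs (path_sorted ps)) e; case: ifP => p1 /=.
    by rewrite prednK // add1n subSS -e.
  have p1' : p = 1%N by lia.
  have s1 : all (fun r => ~~ (1 < r))%N s.
    have := order_path_min trg ps; apply: sub_all => r /=; lia.
  move: e; rewrite -[filter _ _]cats0 (_ : filter _ _ = [::]).
    rewrite (_ : count _ s = 0)%N; last first.
      by apply/eqP; rewrite -leqn0 leqNgt -has_count -all_predC.
    by rewrite p1' /= subn0 => e; rewrite {1}e.
  by apply/eqP; rewrite -(negbK (_ == _)) -has_filter -all_predC.
have sE : sumn s = (sumn t + size s)%N by rewrite {1}e sumn_add_column.
exists t; split=> //; first by rewrite sE leq_addl.
apply/and3P; split; last by rewrite sE addnK.
- apply: (homo_sorted (e := geq)); last exact: sorted_filter.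
  by move=> x y /=; lia.
- by apply/mapP => -[p]; rewrite mem_filter => /andP[p1 _]; lia.
Qed.

(** * Nilpotent matrices and their types *)

Section NilpotentTypes.
Variable K : fieldType.

(** [A] has Jordan blocks of sizes [s], as read off the ranks of its powers. The
    exponents are bounded by [n] to get a boolean; if [s] is a partition of [n],
    the [n]-th power already vanishes. *)
Definition has_type n (A : 'M[K]_n) (s : seq nat) :=
  [forall i : 'I_n.+1, \rank (A ^+ i) == ranksum s i].

Lemma has_typeP n (A : 'M[K]_n) s : is_partition n s ->
  reflect (forall i, \rank (A ^+ i) = ranksum s i) (has_type A s).
Proof.
move=> sn; apply: (iffP forallP) => [At i | At i]; last by rewrite At.
have [le_i_n | lt_n_i] := leqP i n; first exact/eqP/(At (Ordinal (_ : i < n.+1)%N)).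
rewrite (ranksum_eq0 sn (ltnW lt_n_i)); apply/eqP; rewrite -leqn0.
have /eqP An := At ord_max; rewrite (ranksum_eq0 sn (leqnn n)) in An.
by rewrite -An -(subnK (ltnW lt_n_i)) exprD -mulmxE mxrankM_maxr.
Qed.

Lemma has_type_inj n (A : 'M[K]_n) s t : is_partition n s -> is_partition n t ->
  has_type A s -> has_type A t -> s = t.
Proof.
move=> sn tn /(has_typeP _ sn) As /(has_typeP _ tn) At.
by apply: (partition_inj sn tn) => i; rewrite -As At.
Qed.

Lemma has_type_sim n (g A : 'M[K]_n) s : g \in unitmx ->
  has_type (sim g A) s = has_type A s.
Proof.
by move=> gU; apply: eq_forallb => i; rewrite -simX // rank_sim.
Qed.

Lemma has_type_nilpotent n (A : 'M[K]_n) s : is_partition n s ->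
  has_type A s -> A ^+ n = 0.
Proof.
move=> sn /(has_typeP _ sn) /(_ n); rewrite (ranksum_eq0 sn (leqnn n)).
by move/eqP; rewrite mxrank_eq0 => /eqP.
Qed.

Definition ker_block b a (A : 'M[K]_b) (C : 'M[K]_(b, a)) : 'M[K]_(b + a) :=
  block_mx A C 0 0.

Lemma rank_ker_block b a (A : 'M[K]_b) (C : 'M[K]_(b, a)) :
  \rank (ker_block A C) = \rank (row_mx A C).
Proof. by rewrite /ker_block block_mxEv row_mx0 rank_col_mx0. Qed.

Lemma ker_block_exp b a (A : 'M[K]_b) (C : 'M[K]_(b, a)) i :
  ker_block A C ^+ i.+1 = ker_block (A ^+ i *m A) (A ^+ i *m C).
Proof.
elim: i => [|i IHi]; first by rewrite expr1 expr0 !mul1mx.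
rewrite exprSr IHi -mulmxE /ker_block mulmx_block !mulmx0 !mul0mx !addr0.
by rewrite exprSr -mulmxE.
Qed.

Lemma rank_ker_block_exp b a (A : 'M[K]_b) (C : 'M[K]_(b, a)) i :
  row_free (row_mx A C) -> \rank (ker_block A C ^+ i.+1) = \rank (A ^+ i).
Proof.
by move=> rAC; rewrite ker_block_exp rank_ker_block -mul_mx_row mxrankMfree.
Qed.

(** In a basis whose last vectors span the kernel of [A], the last rows of [A]
    vanish; the others are then independent. *)
Lemma ker_block_sim b a (A : 'M[K]_(b + a)) : \rank A = b ->
  exists g B C, [/\ g \in unitmx, row_free (row_mx B C) & sim g A = ker_block B C].
Proof.
move=> rA; pose g := invmx (col_ebase A).
have gU : g \in unitmx by rewrite unitmx_inv col_ebase_unit.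
have lo : dsubmx (sim g A) = 0.
  rewrite /sim -(mulmx_ebase A) rA !mulmxA mulVmx ?col_ebase_unit // mul1mx.
  rewrite -!mulmxA -mul_dsub_mx.
  suff -> : dsubmx (pid_mx b : 'M[K]_(b + a)) = 0 by rewrite mul0mx.
  by apply/matrixP => i j; rewrite !mxE /= ltnNge leq_addr andbF.
have gE : sim g A = ker_block (ulsubmx (sim g A)) (ursubmx (sim g A)).
  by rewrite /ker_block block_mxEv hsubmxK row_mx0 -lo vsubmxK.
exists g, (ulsubmx (sim g A)), (ursubmx (sim g A)); split => //.
by rewrite /row_free -rank_ker_block -gE rank_sim // rA.
Qed.

Lemma ker_block_type b a (A : 'M[K]_b) (C : 'M[K]_(b, a)) t :
    row_free (row_mx A C) -> is_partition b t -> (size t <= a)%N ->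
  has_type (ker_block A C) (add_column a t) = has_type A t.
Proof.
move=> rAC bt ta.
apply/(has_typeP _ (add_column_partition bt ta))/(has_typeP _ bt) => tA i.
  by rewrite -(ranksum_add_column a) -tA rank_ker_block_exp.
case: i => [|i]; last by rewrite rank_ker_block_exp // ranksum_add_column.
by rewrite expr0 mxrank1 ranksum0 sumn_add_column //; case/and3P: bt => _ _ /eqP->.
Qed.

Lemma has_type_rank n (A : 'M[K]_n) s : is_partition n s -> has_type A s ->
  \rank A = (n - size s)%N.
Proof.
move=> sn tA; have [t [sE sz ts tn]] := partition_add_column sn.
rewrite -[A]expr1 ((has_typeP _ sn) tA) sE ranksum_add_column ranksum0 -sE.
by case/and3P: tn => _ _ /eqP.
Qed.

(** By induction on the size: a nilpotent matrix induces one on the quotient by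
    its kernel, and the dimension of the kernel is the first column of the Young
    diagram. *)
Lemma nilpotent_type n (A : 'M[K]_n) e : A ^+ e = 0 ->
  exists2 s, is_partition n s & has_type A s.
Proof.
have [m] := ubnP n; elim: m n A => // m IHm n A nm Ae.
have [n0 | n_gt0] := posnP n.
  exists [::]; first by rewrite n0.
  apply/forallP => i; rewrite /ranksum big_nil -leqn0 -[X in (_ <= X)%N]n0.
  exact: rank_leq_row.
have rA : (\rank A < n)%N.
  rewrite ltn_neqAle rank_leq_row andbT -[_ == _]/(row_free A) row_free_unit.
  apply/negP => AU.
  have : A ^+ e \in unitmx.
    have expU i : A ^+ i \in unitmx; last exact: expU.
    elim: i => [|i IHi]; first by rewrite expr0 unitmx1.
    by rewrite exprS -mulmxE unitmx_mul AU.
  by rewrite Ae -row_free_unit /row_free mxrank0 eq_sym -[_ == _]negbK -lt0n n_gt0.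
have [b rAb] : exists b, \rank A = b by exists (\rank A).
move: rA; rewrite rAb => ltbn.
have [a nE] : exists a, n = (b + a)%N by exists (n - b)%N; rewrite subnKC // ltnW.
subst n; have [g [B [C [gU rBC gA]]]] := ker_block_sim rAb.
have Be : B ^+ e = 0.
  apply/eqP; rewrite -mxrank_eq0 -(rank_ker_block_exp e rBC) -gA -simX //.
  by rewrite rank_sim // exprS Ae mulr0 mxrank0.
have [|t bt tB] := IHm _ B _ Be; first exact: leq_trans ltbn _.
(* The map induced by [C] from the kernel of [B] is injective. *)
have ta : (size t <= a)%N.
  have := mxrank_add (row_mx B 0) (row_mx (0 : 'M_b) C).
  rewrite add_row_mx addr0 add0r (eqP rBC) rank_row_mx0 rank_row_0mx.
  rewrite (has_type_rank bt tB); have := rank_leq_col C.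
  by have := partition_add_column bt => -[_ [_ + _ _]]; lia.
exists (add_column a t); first exact: add_column_partition.
by rewrite -(has_type_sim _ _ gU) gA ker_block_type.
Qed.

Lemma nilpotent_expmx n e (A : 'M[K]_n) : A ^+ e = 0 -> A ^+ n = 0.
Proof. by move=> /nilpotent_type[s sn /(has_type_nilpotent sn)]. Qed.

Lemma row_free_complete k a (P R : 'M[K]_(k, a)) : row_free P -> row_free R ->
  exists2 h, h \in unitmx & P = R *m h.
Proof.
move=> rP rR; have : (P^T == R^T)%MS.
  have full (N : 'M[K]_(k, a)) : row_free N -> row_full N^T.
    by rewrite /row_full mxrank_tr.
  by rewrite !submx_full ?full.
case/eqmxMunitP => h hU e; exists h^T; first by rewrite unitmx_tr.
by apply: trmx_inj; rewrite e trmx_mul trmxK.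
Qed.

(** In the basis given by [col_ebase A], the hypothesis says that the rows of [X]
    beyond the rank of [A] vanish. *)
Lemma kermx_mul_eq0 m n p (A : 'M[K]_(m, n)) (X : 'M[K]_(m, p)) :
  kermx A *m X = 0 -> exists h, X = A *m h.
Proof.
rewrite /kermx -mulmxA => e.
exists (invmx (row_ebase A) *m pid_mx (\rank A) *m invmx (col_ebase A) *m X).
rewrite -[in X in _ = X *m _](mulmx_ebase A) !mulmxA mulmxK ?row_ebase_unit //.
rewrite -[_ *m _ *m pid_mx _]mulmxA pid_mx_id ?rank_leq_col //.
have : (1%:M - copid_mx (\rank A)) *m (invmx (col_ebase A) *m X)
       = invmx (col_ebase A) *m X by rewrite mulmxBl e subr0 mul1mx.
rewrite /copid_mx opprB addrC subrK => e'.
by rewrite -!mulmxA e' mulKVmx ?col_ebase_unit.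
Qed.

Lemma block_unit b a (A : 'M[K]_b) (C : 'M[K]_(b, a)) (D : 'M[K]_a) :
  (block_mx A C 0 D \in unitmx) = (A \in unitmx) && (D \in unitmx).
Proof. by rewrite !unitmxE det_ublock unitrM. Qed.

(** A row vector killed by both [A] and [C] is one of the left kernel of [A]
    killed by [C]; so all that matters about [C] is its restriction to that
    kernel, which must be injective. *)
Lemma row_free_row_mx b a (A : 'M[K]_b) (C : 'M[K]_(b, a)) :
  row_free (row_mx A C) = row_free (row_base (kermx A) *m C).
Proof.
apply/idP/idP => [rC | rNC].
  rewrite /row_free -(rank_row_0mx b).
  have <- : row_base (kermx A) *m A = 0 by apply/sub_kermxP; rewrite eq_row_base.
  by rewrite -mul_mx_row mxrankMfree //; apply: row_base_free.
apply: inj_row_free => v /eqP; rewrite mul_mx_row row_mx_eq0 => /andP[/eqP vA vC].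
have /submxP[w vE] : (v <= row_base (kermx A))%MS.
  by rewrite eq_row_base; apply/sub_kermxP.
move: vC; rewrite vE -mulmxA mulmx_free_eq0 // => /eqP ->.
by rewrite mul0mx.
Qed.

(** Both [C] and [D] embed the left kernel of [A] into the last coordinates, so a
    change of basis [h] there makes them agree on this kernel; the difference
    then factors through [A], and a unipotent conjugation removes it. *)
Lemma ker_block_conj b a (A : 'M[K]_b) (C D : 'M[K]_(b, a)) :
    row_free (row_mx A C) -> row_free (row_mx A D) ->
  exists2 g, g \in unitmx & sim g (ker_block A C) = ker_block A D.
Proof.
move=> rC rD; pose N := row_base (kermx A).
rewrite !row_free_row_mx -/N in rC rD.
have [h hU NCD] := row_free_complete rC rD.
have [k kE] : exists k, C - D *m h = A *m k.
  apply: kermx_mul_eq0; have /submxP[u ->] : (kermx A <= N)%MS by rewrite eq_row_base.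
  by rewrite -mulmxA mulmxBr NCD mulmxA subrr mulmx0.
pose g := block_mx (1%:M : 'M_b) k 0 h.
have gU : g \in unitmx by rewrite block_unit unitmx1.
exists g => //; apply/eqP/simP => //.
rewrite /g /ker_block !mulmx_block !mul0mx !mulmx0 !mul1mx !mulmx1 !addr0.
by rewrite -kE subrK.
Qed.

(** By induction on the size: conjugate first the maps induced on the quotients
    by the kernels, then apply [ker_block_conj]. *)
Lemma has_type_conj n (A B : 'M[K]_n) s : is_partition n s ->
    has_type A s -> has_type B s ->
  exists2 g, g \in unitmx & sim g A = B.
Proof.
have [m] := ubnP n; elim: m n s A B => // m IHm n s A B nm sn tA tB.
have [n0 | n_gt0] := posnP n.
  by subst n; exists 1%:M; rewrite ?unitmx1 // [A]flatmx0 [B]flatmx0 sim1.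
have [t [sE sz ts tn]] := partition_add_column sn.
have s_gt0 : (0 < size s)%N.
  by case/and3P: sn n_gt0 => _ _ /eqP <-; case: (s).
have rA := has_type_rank sn tA; have rB := has_type_rank sn tB.
have [b bE] : exists b, b = (n - size s)%N by exists (n - size s)%N.
have [a aE] : exists a, a = size s by exists (size s).
have nE : n = (b + a)%N by rewrite bE aE subnK.
rewrite -bE in tn rA rB; rewrite -aE in sE sz ts s_gt0; clear bE aE; subst n s.
have [g [A' [C [gU rC gA]]]] := ker_block_sim rA.
have [h [B' [D [hU rD hB]]]] := ker_block_sim rB.
rewrite -(has_type_sim _ _ gU) gA ker_block_type // in tA.
rewrite -(has_type_sim _ _ hU) hB ker_block_type // in tB.
have [|g' g'U g'A] := IHm b t A' B' _ tn tA tB.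
  by rewrite -ltnS; apply: leq_trans nm; rewrite ltnS -addn1 leq_add2l.
pose k := block_mx g' 0 0 (1%:M : 'M_a).
have kU : k \in unitmx by rewrite block_unit g'U unitmx1.
have kAC : sim k (ker_block A' C) = ker_block B' (g' *m C).
  apply/eqP/simP => //; rewrite /k /ker_block !mulmx_block.
  rewrite !mulmx0 !mul0mx !mulmx1 !addr0 add0r.
  by congr block_mx; rewrite -g'A /sim mulmxKV.
have rC' : row_free (row_mx B' (g' *m C)).
  by rewrite /row_free -rank_ker_block -kAC rank_sim // rank_ker_block.
have [l lU lC] := ker_block_conj rC' rD.
exists (invmx h *m (l *m (k *m g))).
  by rewrite !unitmx_mul unitmx_inv hU lU kU gU.
by rewrite !simM ?unitmx_mul ?unitmx_inv ?lU ?kU // gA kAC lC -hB simK.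
Qed.

End NilpotentTypes.

(** * Counting the nilpotent matrices of a given type *)

Section CountingNilpotents.
Variable K : finFieldType.
Local Notation Q := (#|K|%:R : rat).

Definition type_set n s := [set A : 'M[K]_n | has_type A s].

Lemma card_lower0_unit b a :
  #|[set h : 'M[K]_(b + a) | (h \in unitmx) && (dlsubmx h == 0)]|
    = (gl K b * #|K| ^ (b * a) * gl K a)%N.
Proof.
pose f (p : 'M[K]_b * 'M[K]_(b, a) * 'M[K]_a) := block_mx p.1.1 p.1.2 0 p.2.
have fi : injective f.
  by move=> [[A C] D] [[A' C'] D'] /eq_block_mx[/= -> -> _ ->].
rewrite /gl -card_mx -cardsT -!cardsX -(card_imset _ fi).
apply: eq_card => h; rewrite inE; apply/andP/imsetP => [[hU /eqP h0] | [[[A C] D]]].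
  exists (ulsubmx h, ursubmx h, drsubmx h); last first.
    by rewrite /f /= -h0 submxK.
  by rewrite !inE /= andbT -(block_unit _ (ursubmx h)) -h0 submxK.
rewrite !inE /= andbT => /andP[AU DU] ->.
by rewrite /f /= block_unit AU DU block_mxKdl eqxx.
Qed.

Lemma card_row_free_row_mx b a (A : 'M[K]_b) k : \rank A = (b - k)%N -> (k <= b)%N ->
  (#|[set C : 'M[K]_(b, a) | row_free (row_mx A C)]| * #|K| ^ (k * a)
   = #|row_free_set K k a| * #|K| ^ (b * a))%N.
Proof.
move=> rA kb; have kE : \rank (kermx A) = k by rewrite mxrank_ker rA subKn.
rewrite -kE -(card_preim_mulmx (row_free_set K _ a) (row_base_free (kermx A))).
congr (_ * _)%N; apply: eq_card => C.
by rewrite !inE row_free_row_mx.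
Qed.

(** Removing the first column of a Young diagram amounts to passing to the
    quotient by the kernel. The matrices [A], [C] such that [ker_block A C] has
    the type with first column [a] are an [A] of type [t] and a [C] that embeds
    its kernel, of dimension [size t], into a space of dimension [a]; and the
    units that conjugate such a matrix to another one are those that preserve
    the kernel. *)
Lemma card_type_set_add_column b a t : is_partition b t -> (size t <= a)%N ->
  #|type_set (b + a) (add_column a t)|%:R / (gl K (b + a))%:R
  = (#|type_set b t|%:R / (gl K b)%:R)
    * (#|row_free_set K (size t) a|%:R / ((gl K a)%:R * Q ^+ (size t * a))).
Proof.
move=> bt ta.
pose X := type_set (b + a) (add_column a t).
pose H := [set h : 'M[K]_(b + a) | (h \in unitmx) && (dlsubmx h == 0)].
pose Yof (p : 'M[K]_b * 'M[K]_(b, a)) := ker_block p.1 p.2.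
pose Yin := [set p : 'M[K]_b * 'M[K]_(b, a) |
               has_type p.1 t && row_free (row_mx p.1 p.2)].
pose Y := [set Yof p | p in Yin].
have Yof_inj : injective Yof by move=> [A C] [A' C'] /eq_block_mx[/= -> ->].
have YP A C : (ker_block A C \in Y) = has_type A t && row_free (row_mx A C).
  by rewrite (mem_imset _ (A, C) Yof_inj) inE.
have XE A C : row_free (row_mx A C) -> (ker_block A C \in X) = has_type A t.
  by move=> rAC; rewrite inE ker_block_type.
have rX x : x \in X -> \rank x = b.
  rewrite inE => /(has_type_rank (add_column_partition bt ta)) ->.
  by rewrite size_cat size_map size_nseq subnKC ?addnK.
have XYH : (#|X| * #|H| = gl K (b + a) * #|Y|)%N.
  apply: orbit_count => [h | g y gU /imsetP[[A C] +] -> | x Xx | h y hU].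
  - by rewrite inE => /andP[].
  - by rewrite inE /= => /andP[tA rAC]; rewrite inE has_type_sim // ker_block_type.
  - have [g [A [C [gU rAC gx]]]] := ker_block_sim (rX _ Xx).
    exists g => //; rewrite gx YP rAC andbT -(XE _ _ rAC) -gx.
    by rewrite inE has_type_sim //; rewrite inE in Xx.
  case/imsetP=> [[A C] +] ->; rewrite inE /= => /andP[tA rAC].
  rewrite inE hU /=; apply/imsetP/eqP => [[[A' C'] _ /eqP/(simP _ _ hU)] | h0].
    rewrite -{1 2}[h]submxK /Yof /ker_block /= !mulmx_block !mul0mx !mulmx0 !addr0.
    case/eq_block_mx => _ _ hA hC; apply/eqP.
    by rewrite -(mulmx_free_eq0 _ rAC) mul_mx_row hA hC row_mx0.
  pose h1 := ulsubmx h; pose h2 := ursubmx h; pose h3 := drsubmx h.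
  have hE : h = block_mx h1 h2 0 h3 by rewrite -h0 submxK.
  have /andP[h1U h3U] : (h1 \in unitmx) && (h3 \in unitmx).
    by rewrite -(block_unit _ h2) -hE.
  pose A' := sim h1 A; pose C' := (h1 *m C - A' *m h2) *m invmx h3.
  have hAC : sim h (Yof (A, C)) = ker_block A' C'.
    apply/eqP/simP => //; rewrite hE /Yof /ker_block /= !mulmx_block.
    rewrite !mul0mx !mulmx0 !addr0 /C' {1}/A' /sim.
    by rewrite !mulmxKV // addrC subrK.
  exists (A', C') => //; rewrite inE /= has_type_sim // tA /=.
  by rewrite /row_free -rank_ker_block -hAC rank_sim // rank_ker_block.
have cH : #|H| = (gl K b * #|K| ^ (b * a) * gl K a)%N by exact: card_lower0_unit.
have cY : (#|Y| * #|K| ^ (size t * a)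
           = #|type_set b t| * (#|row_free_set K (size t) a| * #|K| ^ (b * a)))%N.
  rewrite card_imset // -sum1_card (partition_big fst (mem (type_set b t))) /=; last first.
    by move=> [A C]; rewrite !inE /= => /andP[].
  rewrite big_distrl -sum_nat_const; apply: eq_bigr => A; rewrite !inE => tA.
  have tb : (size t <= b)%N by have [u [_ ->]] := partition_add_column bt.
  rewrite -(card_row_free_row_mx a (has_type_rank bt tA) tb); congr (_ * _)%N.
  have pi : injective (pair A : 'M[K]_(b, a) -> _) by move=> ? ? [].
  rewrite sum1dep_card -(card_imset [set C : 'M_(b, a) | row_free (row_mx A C)] pi).
  apply: eq_card => -[A' C]; rewrite !inE /=.
  apply/andP/imsetP => [[/andP[_ rAC] /eqP AA] | [C' + [-> ->]]].
    by subst A'; exists C; rewrite ?inE.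
  by rewrite inE tA => ->.
have Q0 : Q != 0 by rewrite pnatr_eq0 -lt0n; apply/card_gt0P; exists 0.
have g0 n : (gl K n)%:R != 0 :> rat by rewrite pnatr_eq0 -lt0n gl_gt0.
move/(congr1 (fun n => n%:R : rat)): XYH; move/(congr1 (fun n => n%:R : rat)): cY.
rewrite cH !natrM !natrX => cY XYH; rewrite -/X.
have -> : #|X|%:R = (gl K (b + a))%:R * #|Y|%:R
                    / ((gl K b)%:R * Q ^+ (b * a) * (gl K a)%:R) :> rat.
  by rewrite -XYH mulfK // !mulf_neq0 ?expf_neq0.
have -> : #|Y|%:R = #|type_set b t|%:R
    * (#|row_free_set K (size t) a|%:R * Q ^+ (b * a)) / Q ^+ (size t * a) :> rat.
  by rewrite -cY mulfK // expf_neq0.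
by field; rewrite !expf_neq0 ?g0 ?Q0.
Qed.

End CountingNilpotents.

Section Weights.
Variables (q d : nat).
Local Notation Q := (q%:R ^+ d : rat).

Lemma qpochE m : qpoch q d m = \prod_(1 <= k < m.+1) (1 - Q ^- k).
Proof. by apply: eq_bigr => k _; rewrite exprM div1r. Qed.

Lemma qpoch0 : qpoch q d 0 = 1. Proof. by rewrite /qpoch big_geq. Qed.

Lemma transpose_add_column a t : (0 < a)%N -> (size t <= a)%N -> 0%N \notin t ->
  transpose (add_column a t) = a :: transpose t.
Proof.
move=> a0 ta t0; rewrite /transpose.
have le_max (r : seq nat) p : p \in r -> (p <= \max_(x <- r) x)%N.
  by move=> rp; apply: (@leq_bigmax_seq _ r predT (fun x => x)).
have -> : (\max_(p <- add_column a t) p = (\max_(p <- t) p).+1)%N.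
  set m := (\max_(p <- add_column a t) p)%N.
  have m_gt0 : (0 < m)%N.
    case: (t) @m => [|p u]; last by apply: leq_trans (le_max _ p.+1 _); rewrite // inE eqxx.
    by apply: le_max; rewrite mem_cat mem_nseq subn0 a0.
  rewrite -(prednK m_gt0); congr _.+1; apply/eqP; rewrite eqn_leq; apply/andP; split.
    rewrite -ltnS prednK //; apply/bigmax_leqP_seq => p.
    rewrite mem_cat => /orP[/mapP[r rt ->] | /nseqP[-> _]] // _.
    by rewrite ltnS le_max.
  apply/bigmax_leqP_seq => p pt _; rewrite -ltnS prednK //.
  by apply: le_max; rewrite mem_cat map_f.
have cnt i : (count (leq i.+2) (add_column a t) = count (leq i.+1) t)%N.
  rewrite count_cat count_map count_nseq /= mul0n addn0.
  by apply: eq_count => p.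
rewrite /= -[2%N]/(1 + 1)%N iotaDl -map_comp; congr (_ :: _).
  rewrite count_cat count_map count_nseq /= mul1n (eq_count (a2 := predT)) //.
  by rewrite count_predT subnKC.
by apply/eq_in_map => -[|i]; rewrite mem_iota //= => _; apply: cnt.
Qed.

Lemma prod_qpoch_add_column b a t : is_partition b t -> (size t <= a)%N -> (0 < a)%N ->
  \prod_(1 <= i < (b + a).+1) qpoch q d (count_mem i (add_column a t))
  = qpoch q d (a - size t) * \prod_(1 <= i < b.+1) qpoch q d (count_mem i t).
Proof.
move=> bt ta a0; have /and3P[_ t0 _] := bt.
rewrite big_ltn ?ltnS ?(leq_trans a0) ?leq_addl // big_add1 /=; congr (_ * _).
  rewrite count_cat count_map count_nseq /= mul1n (eq_count (a2 := pred1 0%N)) //.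
  by rewrite (count_memPn t0).
have ba : (b.+1 <= b + a)%N by lia.
rewrite (big_cat_nat (n := b.+1)) //= [X in _ * X]big_nat_cond.
rewrite [X in _ * X]big1 ?mulr1.
  apply: eq_big_nat => i /andP[i0 _].
  case: i i0 => // i _; congr (qpoch q d _).
  by rewrite count_cat count_map count_nseq /= mul0n addn0; apply: eq_count.
move=> i /andP[/andP[bi _] _].
suff -> : count_mem i.+1 (add_column a t) = 0%N by rewrite qpoch0.
apply/count_memPn; rewrite mem_cat negb_or mem_nseq; apply/andP; split; last by lia.
apply/mapP => -[p pt [ip]]; have := partition_part_le bt pt; lia.
Qed.

End Weights.

Section CountingTypes.
Variables (K : finFieldType) (q d : nat).
Hypothesis qK : #|K| = (q ^ d)%N.
Local Notation Q := (#|K|%:R : rat).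

(** The number of units over that of row-free matrices is the product of the last
    [a - k] factors [Q ^ a - Q ^ i] of the former; taking [Q ^ a] out of each
    leaves the q-Pochhammer symbol. *)
Lemma card_row_free_gl k a : (k <= a)%N ->
  (gl K a)%:R * Q ^+ (k * a)
  = #|row_free_set K k a|%:R * (Q ^+ (a ^ 2) * qpoch q d (a - k)).
Proof.
move=> ka; have Q0 : Q != 0 by rewrite pnatr_eq0 -lt0n; apply/card_gt0P; exists 0.
rewrite gl_row_free !card_row_free_set (big_cat_nat (n := k)) //= -!mulrA.
congr (_ * _).
have -> : Q ^+ (a ^ 2) = Q ^+ (a * (a - k)) * Q ^+ (k * a).
  by rewrite -exprD; congr (_ ^+ _); nia.
rewrite mulrAC; congr (_ * _).
have QE : q%:R ^+ d = Q by rewrite qK natrX.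
rewrite qpochE QE exprM; have [l ->] : exists l, a = (k + l)%N by exists (a - k)%N; lia.
rewrite addKn.
have -> : (Q ^+ (k + l)) ^+ l = \prod_(0 <= i < l) Q ^+ (k + l).
  by rewrite prodr_const_nat subn0.
rewrite big_add1 -big_split /= -{1}[k]add0n big_addn addKn.
rewrite big_nat_rev /=; apply: eq_big_nat => i /andP[_ il].
rewrite mulrBr mulr1 -exprB ?unitfE //; last by lia.
by congr (_ - _ ^+ _); lia.
Qed.

(** Column by column: a first column of height [a], followed by one of height
    [k], contributes [Q ^ (a ^ 2)] and the symbol of index [a - k], which is the
    number of parts equal to 1. *)
Lemma card_type_set m s : is_partition m s ->
  #|type_set K m s|%:R / (gl K m)%:R = partition_weight q d m s.
Proof.
have [u] := ubnP m; elim: u m s => // u IHu m s mu ms.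
have [t [sE sz ts tm]] := partition_add_column ms.
have [s0 | s_gt0] := posnP (size s).
  move: sE; rewrite /add_column s0.
  have t0 : t = [::] by apply: size0nil; lia.
  rewrite t0 /= => sE; subst s; have {ms} m0 : m = 0%N by case/and3P: ms => _ _ /eqP.
  subst m; rewrite /partition_weight big_geq // /transpose big_nil big_nil muln0.
  rewrite expr0 mulr1 gl_row_free (_ : row_free_set K 0 0 = type_set K 0 [::]).
    rewrite divrr // unitfE pnatr_eq0 -lt0n; apply/card_gt0P; exists 0.
    by rewrite inE; apply/forallP => i; rewrite flatmx0 mxrank0 /ranksum big_nil.
  apply/setP => A; rewrite !inE /row_free flatmx0 mxrank0 eqxx; apply/esym/forallP => i.
  by rewrite flatmx0 mxrank0 /ranksum big_nil.
have [b bE] : exists b, b = (m - size s)%N by exists (m - size s)%N.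
have [a aE] : exists a, a = size s by exists (size s).
have mE : m = (b + a)%N by rewrite bE aE subnK.
rewrite -bE in tm; rewrite -aE in sE sz ts s_gt0; clear bE aE; subst m s.
rewrite card_type_set_add_column // IHu //; last by lia.
have /and3P[_ t0 _] := tm.
rewrite /partition_weight transpose_add_column // big_cons prod_qpoch_add_column //.
rewrite card_row_free_gl // mulnDr exprD.
have -> : q%:R ^+ (d * a ^ 2) = Q ^+ (a ^ 2) by rewrite qK natrX exprM.
have r0 : #|row_free_set K (size t) a|%:R != 0 :> rat.
  apply/eqP => r0; have := card_row_free_gl ts; rewrite r0 mul0r => /eqP.
  rewrite mulf_eq0 pnatr_eq0 expf_eq0 pnatr_eq0 !eqn0Ngt gl_gt0 /=.
  by case/andP=> _ /negP[]; apply/card_gt0P; exists 0.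
have cancel_r (x y : rat) : x != 0 -> x / (x * y) = y^-1.
  by move=> x0; rewrite invfM mulrA divff ?mul1r.
by rewrite cancel_r // !div1r -!invfM; congr (_^-1); ring.
Qed.

End CountingTypes.

(** * Powers of nilpotent matrices *)

Section ThetaPartitions.
Variable M : nat.
Hypothesis M_gt0 : (0 < M)%N.

(** On the ranks of powers, [Theta M] is the passage from a matrix to its
    [M]-th power; the underlying identity is the case of one part. *)
Lemma ranksum_Theta s i : ranksum (Theta M s) i = ranksum s (M * i).
Proof.
rewrite /ranksum /Theta (perm_big _ (permEl (perm_sort _ _))) big_filter.
rewrite big_mkcond [LHS](eq_bigr (fun p => p - i)%N) => [|[|p] _] //=.
elim: s => [|p s IHs]; first by rewrite !big_nil.
rewrite /= big_cat big_cons /= IHs; congr (_ + _)%N.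
have nseqE m p' : (\sum_(x <- nseq m p') (x - i) = m * (p' - i))%N.
  by elim: m => [|m IHm]; rewrite ?big_nil // big_cons IHm mulSn.
rewrite big_cat /= !nseqE; have pE := divn_eq p M; have := ltn_pmod p M_gt0.
have : ceil_div p M = (p %/ M + (0 < p %% M))%N.
  rewrite /ceil_div {1}pE -addnA divnMDl //; congr (_ + _)%N.
  have := ltn_pmod p M_gt0; case: posnP => [-> _ | r0 rM].
    by rewrite divn_small // add0n; lia.
  have -> : (p %% M + M.-1 = 1 * M + (p %% M).-1)%N by lia.
  by rewrite divnMDl // divn_small ?addn0 //; lia.
move: (p %% M)%N (p %/ M)%N pE => r a -> -> rM.
case: (posnP r) => [-> | r0] /=.
  by rewrite mul0n add0n addn0 subn0 mulnBr (mulnC a).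
have [ia | ai] := leqP i a.
  have [c ->] : exists c, a = (i + c)%N by exists (a - i)%N; lia.
  by rewrite addKn; nia.
have -> : (a - i = 0)%N by lia.
have -> : (a + 1 - i = 0)%N by lia.
rewrite !muln0; apply/esym/eqP; rewrite subn_eq0; nia.
Qed.

Lemma Theta_partition n s : is_partition n s -> is_partition n (Theta M s).
Proof.
case/and3P=> _ _ /eqP sn; apply/and3P; split.
- apply: sort_sorted => x y; exact: leq_total.
- by rewrite mem_sort mem_filter.
- by rewrite -ranksum0 ranksum_Theta muln0 ranksum0 sn.
Qed.

Variable K : fieldType.

Lemma has_type_exp n (A : 'M[K]_n) s : is_partition n s -> has_type A s ->
  has_type (A ^+ M) (Theta M s).
Proof.
move=> sn /(has_typeP _ sn) As; apply/(has_typeP _ (Theta_partition sn)) => i.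
by rewrite -exprM As ranksum_Theta.
Qed.

End ThetaPartitions.

Definition nil_powers (K : finFieldType) M m :=
  [set A : 'M[K]_m | [exists x : 'M[K]_m, (x ^+ m == 0) && (A == x ^+ M)]].

Section CountingNilPowers.
Variables (K : finFieldType) (M : nat).
Hypothesis M_gt0 : (0 < M)%N.

(** The number of matrices of a given type is not zero, since its weight is
    not. *)
Lemma exists_has_type m s : is_partition m s -> exists A : 'M[K]_m, has_type A s.
Proof.
move=> ms; have qK : #|K| = (#|K| ^ 1)%N by [].
have K1 : (1 < #|K|)%N := finNzRing_gt1 K.
have := card_type_set qK ms; set w := partition_weight _ _ _ _ => cE.
have : #|type_set K m s|%:R != 0 :> rat.
  apply: contraTneq isT => c0; move: cE; rewrite c0 mul0r => /esym/eqP.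
  rewrite /w /partition_weight div1r invr_eq0 mulf_eq0 expf_eq0 pnatr_eq0.
  rewrite (gtn_eqF (ltnW K1)) andbF /= prodf_seq_eq0 => /hasP[i _] /=.
  rewrite prodf_seq_eq0 => /hasP[j]; rewrite mem_index_iota => /andP[j0 _] /=.
  rewrite mul1n div1r subr_eq0 eq_sym invr_eq1 -natrX pnatr_eq1.
  by rewrite -[X in _ == X](expn0 #|K|) eqn_exp2l // (gtn_eqF j0).
rewrite pnatr_eq0 -lt0n => /card_gt0P[A]; rewrite inE => tA.
by exists A.
Qed.

(** If the type of [A] is that of the [M]-th power of a matrix, which exists with
    any prescribed type, then [A] is conjugate to this power, hence a power. *)
Lemma nil_powersP m (A : 'M[K]_m) :
  reflect (exists s, [/\ is_partition m s, has_type A s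
                       & s \in [seq Theta M t | t <- partitions m]])
          (A \in nil_powers K M m).
Proof.
rewrite inE; apply: (iffP existsP) => [[x /andP[/eqP]] | [s [ms As /mapP[t tm sE]]]].
  move=> /nilpotent_type[t mt xt] /eqP ->.
  exists (Theta M t); split; [exact: Theta_partition | exact: has_type_exp |].
  by apply: map_f; rewrite mem_partitions.
rewrite mem_partitions in tm; have [x xt] := exists_has_type tm.
have xMs : has_type (x ^+ M) s by rewrite sE has_type_exp.
have [g gU gE] := has_type_conj ms xMs As.
exists (sim g x); rewrite -!simX // gE eqxx andbT.
by rewrite (has_type_nilpotent tm xt) /sim mulmx0 mul0mx.
Qed.

Lemma nil_powers_sim m (g A : 'M[K]_m) : g \in unitmx ->
  A \in nil_powers K M m -> sim g A \in nil_powers K M m.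
Proof.
move=> gU; rewrite !inE => /existsP[x /andP[/eqP x0 /eqP ->]].
apply/existsP; exists (sim g x); rewrite -!simX // x0 eqxx andbT.
by rewrite /sim mulmx0 mul0mx.
Qed.

Lemma nil_powers_nilpotent m (A : 'M[K]_m) : A \in nil_powers K M m -> A ^+ m = 0.
Proof.
rewrite inE => /existsP[x /andP[/eqP x0 /eqP ->]].
by rewrite exprAC x0 expr0n gtn_eqF.
Qed.

Lemma card_nil_powers q d m : #|K| = (q ^ d)%N ->
  #|nil_powers K M m|%:R / (gl K m)%:R
  = \sum_(s <- partitions m | s \in [seq Theta M t | t <- partitions m])
      partition_weight q d m s.
Proof.
move=> qK; set im := [seq Theta M t | t <- _].
rewrite big_seq_cond; under eq_bigr => s /andP[].
  rewrite mem_partitions => ms _; rewrite -(card_type_set qK ms).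
  over.
rewrite -big_seq_cond -big_distrl /=; congr (_ / _).
rewrite -natr_sum; congr _%:R.
under [RHS]eq_bigr => s _ do rewrite -sum1_card big_mkcond /=.
rewrite exchange_big -sum1_card big_mkcond /=; apply: eq_bigr => A _.
case: nil_powersP => [[s [ms As sim]] | nA].
  rewrite big_mkcond (bigD1_seq s) ?mem_partitions ?uniq_partitions //= sim.
  rewrite inE As big_seq_cond big1 // => t /andP[]; rewrite mem_partitions => mt ts.
  rewrite inE; case: ifP => // _; case: ifP => // At.
  by rewrite (has_type_inj ms mt As At) eqxx in ts.
rewrite big_seq_cond big1 // => s /andP[]; rewrite mem_partitions => ms sim.
by rewrite inE; case: ifP => // As; case: nA; exists s.
Qed.

End CountingNilPowers.

(** * Polynomials in a matrix and the Frobenius power *)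

Section Evaluation.
Variable F : fieldType.
Implicit Types (p r : {poly F}).

(** Unlike [horner_mx], this makes sense for matrices of size 0 as well, which
    occur as blocks in the coprime decomposition. *)
Definition peval n (A : 'M[F]_n) p : 'M[F]_n := \sum_(i < size p) p`_i *: A ^+ i.

Lemma peval_horner n (A : 'M[F]_n.+1) p : peval A p = horner_mx A p.
Proof.
rewrite -{2}[p]coefK poly_def raddf_sum; apply: eq_bigr => i _.
by rewrite /= horner_mxZ rmorphXn /= horner_mx_X.
Qed.

Lemma mx0_eq m (A B : 'M[F]_(0, m)) : A = B.
Proof. by rewrite [A]flatmx0 [B]flatmx0. Qed.

Lemma peval1 n (A : 'M[F]_n) : peval A 1 = 1%:M.
Proof. by case: n A => [|n] A; [exact: mx0_eq | rewrite peval_horner rmorph1]. Qed.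

Lemma pevalD n (A : 'M[F]_n) p r : peval A (p + r) = peval A p + peval A r.
Proof. by case: n A => [|n] A; [exact: mx0_eq | rewrite !peval_horner rmorphD]. Qed.

Lemma pevalM n (A : 'M[F]_n) p r : peval A (p * r) = peval A p *m peval A r.
Proof. by case: n A => [|n] A; [exact: mx0_eq | rewrite !peval_horner rmorphM]. Qed.

Lemma pevalX n (A : 'M[F]_n) : peval A 'X = A.
Proof. by case: n A => [|n] A; [exact: mx0_eq | rewrite peval_horner horner_mx_X]. Qed.

Lemma peval_exp n (A : 'M[F]_n) p i : peval A (p ^+ i) = peval A p ^+ i.
Proof. by elim: i => [|i IHi]; rewrite ?peval1 ?expr0 // !exprS pevalM IHi. Qed.

Lemma intertwine_exp m n (g : 'M[F]_(m, n)) A B i :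
  g *m A = B *m g -> g *m A ^+ i = B ^+ i *m g.
Proof.
move=> gAB; elim: i => [|i IHi]; first by rewrite !expr0 mulmx1 mul1mx.
by rewrite [A ^+ _]exprS [B ^+ _]exprS -!mulmxE mulmxA gAB -!mulmxA IHi.
Qed.

Lemma intertwine_peval m n (g : 'M[F]_(m, n)) A B p :
  g *m A = B *m g -> g *m peval A p = peval B p *m g.
Proof.
move=> gAB; rewrite /peval mulmx_sumr mulmx_suml; apply: eq_bigr => i _.
by rewrite -scalemxAr -scalemxAl (intertwine_exp i gAB).
Qed.

Lemma peval_sim n (g A : 'M[F]_n) p : g \in unitmx ->
  peval (sim g A) p = sim g (peval A p).
Proof.
move=> gU; apply/esym/eqP/simP => //; apply: intertwine_peval.
by rewrite /sim mulmxKV.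
Qed.

Definition block_diag a b (A : 'M[F]_a) (B : 'M[F]_b) : 'M[F]_(a + b) :=
  block_mx A 0 0 B.

Lemma block_diag_exp a b (A : 'M[F]_a) (B : 'M[F]_b) i :
  block_diag A B ^+ i = block_diag (A ^+ i) (B ^+ i).
Proof.
elim: i => [|i IHi]; first by rewrite !expr0 [LHS]scalar_mx_block.
rewrite !exprS IHi -!mulmxE /block_diag mulmx_block.
by rewrite !mulmx0 !mul0mx !addr0 add0r.
Qed.

Lemma block_diag_peval a b (A : 'M[F]_a) (B : 'M[F]_b) p :
  peval (block_diag A B) p = block_diag (peval A p) (peval B p).
Proof.
rewrite /peval /block_diag.
under eq_bigr => i _.
  rewrite block_diag_exp scale_block_mx !scaler0; over.
elim/big_rec3: _ => [|i u v w _ ->]; first by rewrite block_mx0.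
by rewrite add_block_mx !addr0.
Qed.

End Evaluation.

Section Frobenius.

Lemma frobenius_comm (R : nzRingType) M (x y : R) i : M \in [pchar R] ->
  GRing.comm x y -> (x + y) ^+ (M ^ i) = x ^+ (M ^ i) + y ^+ (M ^ i).
Proof.
move=> pM xy; elim: i => [|i IHi]; first by rewrite !expr1.
rewrite expnSr !exprM IHi -!(pFrobenius_autE pM) pFrobenius_autD_comm //.
exact/commrX/commr_sym/commrX/commr_sym.
Qed.

Lemma frobenius_comm_sub (R : nzRingType) M (x y : R) i : M \in [pchar R] ->
  GRing.comm x y -> (x - y) ^+ (M ^ i) = x ^+ (M ^ i) - y ^+ (M ^ i).
Proof.
move=> pM xy; apply/eqP; rewrite -subr_eq0 opprB addrA subr_eq0; apply/eqP.
by rewrite -frobenius_comm ?subrK //; apply/commr_sym/commrB; rewrite ?/GRing.comm.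
Qed.

Variables (M k : nat) (F : finFieldType).
Hypotheses (M_prime : prime M) (cardF : #|F| = (M ^ k)%N).

Lemma pcharF : M \in [pchar F]. Proof. exact: card_finPcharP cardF M_prime. Qed.

Lemma expf_card_iter (x : F) i : x ^+ (#|F| ^ i) = x.
Proof. by elim: i => [|i IHi]; rewrite ?expr1 // expnSr exprM IHi expf_card. Qed.

(** The Frobenius power fixes the coefficients of [p], and the powers of [A]
    commute. *)
Lemma peval_frobenius n (A : 'M[F]_n) (p : {poly F}) i :
  peval A p ^+ (#|F| ^ i) = peval (A ^+ (#|F| ^ i)) p.
Proof.
case: n A => [|n] A; first exact: mx0_eq.
set E := (#|F| ^ i)%N.
have pE : p ^+ E = \sum_(j < size p) p`_j *: 'X^E ^+ j.
  rewrite -{1}[p]coefK poly_def.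
  elim/big_rec2: _ => [|j u v _ <-].
    by rewrite expr0n gtn_eqF // expn_gt0 (ltnW (finNzRing_gt1 F)).
  rewrite /E cardF -expnM frobenius_comm //; last exact: mulrC.
    by rewrite -mul_polyC exprMn -rmorphXn /= expnM -cardF expf_card_iter mul_polyC exprAC.
  by rewrite pchar_poly pcharF.
rewrite -peval_exp pE peval_horner raddf_sum; apply: eq_bigr => j _.
by rewrite /= horner_mxZ !rmorphXn /= horner_mx_X.
Qed.

End Frobenius.

(** * Coprime decomposition *)

Section CoprimeDecomposition.
Variables (F : finFieldType) (M : nat).
Implicit Types (p r : {poly F}).

Definition powers p n :=
  [set x : 'M[F]_n | (peval x p == 0) && [exists y : 'M[F]_n, x == y ^+ M]].

Lemma powersP p n (x : 'M[F]_n) :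
  reflect (peval x p = 0 /\ exists y, x = y ^+ M) (x \in powers p n).
Proof.
rewrite inE; apply: (iffP andP) => [[/eqP-> /existsP[y /eqP->]] | [-> [y ->]]].
  by split=> //; exists y.
by rewrite eqxx; split=> //; apply/existsP; exists y.
Qed.

Lemma powers_sim p n (g x : 'M[F]_n) : g \in unitmx ->
  x \in powers p n -> sim g x \in powers p n.
Proof.
move=> gU /powersP[px [y xE]]; apply/powersP; split.
  by rewrite peval_sim // px /sim mulmx0 mul0mx.
by exists (sim g y); rewrite xE simX.
Qed.

Lemma row_base_rank m n (R : 'M[F]_(m, n)) a : \rank R = a ->
  exists U : 'M_(a, n), row_free U /\ (U :=: R)%MS.
Proof.
by move=> <-; exists (row_base R); split; [exact: row_base_free | exact: eq_row_base].
Qed.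

Lemma peval_unit p r n (x : 'M[F]_n) : coprimep p r -> peval x p = 0 ->
  peval x r \in unitmx.
Proof.
move=> /Bezout_eq1_coprimepP[[u v] /= uv] px.
have := congr1 (peval x) uv; rewrite pevalD !pevalM px mulmx0 add0r peval1.
by case/mulmx1_unit.
Qed.

Lemma coprime_rank p r n (x : 'M[F]_n) : coprimep p r -> peval x (p * r) = 0 ->
  (\rank (peval x p) + \rank (peval x r))%N = n.
Proof.
move=> /Bezout_eq1_coprimepP[[u v] /= uv]; rewrite pevalM => pr0.
apply/eqP; rewrite eqn_leq; apply/andP; split.
  exact: mulmx0_rank_max.
have := congr1 (peval x) uv; rewrite pevalD !pevalM peval1 => one.
rewrite -{1}(mxrank1 F n) -one; apply: leq_trans (mxrank_add _ _) _.
by rewrite leq_add // mxrankM_maxr.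
Qed.

(** A matrix killed by [p * r] has the block [ker p] spanned by the rows of its
    value at [r], and conversely; its [M]-th roots commute with it, hence
    respect the two blocks. *)
Lemma coprime_block_sim p r a b (x : 'M[F]_(a + b)) : coprimep p r ->
    x \in powers (p * r) (a + b) -> \rank (peval x r) = a ->
  exists g A B, [/\ g \in unitmx, A \in powers p a, B \in powers r b
                  & sim g x = block_diag A B].
Proof.
move=> cpr /powersP[prx [y xE]] rr.
have rp : \rank (peval x p) = b.
  by have := coprime_rank cpr prx; rewrite rr; lia.
have [U [Ufree UE]] := row_base_rank rr; have [V [Vfree VE]] := row_base_rank rp.
have root c s t (W : 'M[F]_(c, a + b)) : peval x (s * t) = 0 -> row_free W ->
    (W :=: peval x s)%MS -> exists A, A \in powers t c /\ W *m x = A *m W.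
  move=> st0 Wfree WE.
  have yW : (W *m y <= W)%MS.
    have sy : peval x s *m y = y *m peval x s.
      by apply/esym/intertwine_peval; rewrite xE mulmxE -exprS exprSr.
    by rewrite WE (eqmxMr y WE) sy submxMl.
  have [B yB] := submxP yW; have xB : W *m x = B ^+ M *m W.
    by rewrite xE; apply: intertwine_exp.
  exists (B ^+ M); split=> //; apply/powersP; split; last by exists B.
  apply/eqP; rewrite -(mulmx_free_eq0 _ Wfree) -(intertwine_peval t xB).
  have /submxP[Z ->] : (W <= peval x s)%MS by rewrite WE.
  by rewrite -mulmxA -pevalM st0 mulmx0.
have [A [pA UA]] := root _ r p U (etrans (congr1 _ (mulrC r p)) prx) Ufree UE.
have [B [rB VB]] := root _ p r V prx Vfree VE.
have gU : col_mx U V \in unitmx.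
  have /Bezout_eq1_coprimepP[[u v] /= uv] := cpr.
  have := congr1 (peval x) uv; rewrite pevalD !pevalM peval1 => one.
  rewrite -row_full_unit -sub1mx -addsmxE -one addmx_sub //.
    by rewrite (submx_trans (submxMl _ _)) // -VE addsmxSr.
  by rewrite (submx_trans (submxMl _ _)) // -UE addsmxSl.
exists (col_mx U V), A, B; split => //; apply/eqP/simP => //.
by rewrite mul_col_mx UA VB /block_diag mul_block_col !mul0mx addr0 add0r.
Qed.

(** A unit that intertwines two block diagonal matrices intertwines their values
    at [p]; as these are zero on the first block and invertible on the second,
    it is block diagonal. *)
Lemma card_coprime_block p r a b : coprimep p r ->
  (#|[set x in powers (p * r) (a + b) | \rank (peval x r) == a]|
     * (gl F a * gl F b) = gl F (a + b) * (#|powers p a| * #|powers r b|))%N.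
Proof.
move=> cpr; pose f (z : 'M[F]_a * 'M[F]_b) := block_diag z.1 z.2.
have fi : injective f by move=> [A B] [A' B'] /eq_block_mx[/= -> _ _ ->].
pose Y := f @: setX (powers p a) (powers r b).
pose U n := [set g : 'M[F]_n | g \in unitmx].
pose H := f @: setX (U a) (U b).
have YP A B : (block_diag A B \in Y) = (A \in powers p a) && (B \in powers r b).
  by rewrite (mem_imset _ (A, B) fi) !inE.
have -> : (gl F a * gl F b)%N = #|H| by rewrite card_imset // cardsX.
have -> : (#|powers p a| * #|powers r b|)%N = #|Y| by rewrite card_imset // cardsX.
have pr0 A B : A \in powers p a -> B \in powers r b ->
    peval (block_diag A B) p = block_diag 0 (peval B p) /\ peval B p \in unitmx.
  move=> /powersP[pA _] /powersP[rB _]; rewrite block_diag_peval pA; split=> //.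
  by apply: peval_unit rB; rewrite coprimep_sym.
apply: orbit_count => [h | g _ gU /imsetP[[A B] /setXP[/= pA rB] ->] | x | h y hU].
- case/imsetP=> [[A B] /setXP[]]; rewrite !inE /= => AU BU ->.
  by rewrite /f block_diag_mx_unit AU.
- rewrite inE peval_sim // rank_sim // powers_sim //=.
    have /powersP[pA0 _] := pA; have /powersP[rB0 _] := rB.
    rewrite /f block_diag_peval rB0 rank_diag_block_mx mxrank0 addn0.
    by rewrite mxrank_unit // (peval_unit cpr).
  have /powersP[pA0 [w wA]] := pA; have /powersP[rB0 [z zB]] := rB.
  apply/powersP; split; last by exists (block_diag w z); rewrite block_diag_exp /f /= wA zB.
  by rewrite /f block_diag_peval !pevalM pA0 rB0 mul0mx mulmx0 /block_diag block_mx0.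
- rewrite inE => /andP[xpr /eqP rx].
  have [g [A [B [gU pA rB gx]]]] := coprime_block_sim cpr xpr rx.
  by exists g => //; rewrite gx YP pA.
case/imsetP=> [[A B] /setXP[/= pA rB] ->]; rewrite /f /=.
apply/imsetP/imsetP => [[[A' B'] /setXP[/= pA' rB'] e] | [[h1 h2] /setXP[]]].
  have hAB : h *m block_diag A B = block_diag A' B' *m h by apply/(simP _ _ hU)/eqP.
  have hp := intertwine_peval p hAB; have hr := intertwine_peval r hAB.
  have [pE pBU] := pr0 _ _ pA rB; have [pE' pBU'] := pr0 _ _ pA' rB'.
  move: hp; rewrite pE pE' -{1 2}[h]submxK /block_diag !mulmx_block.
  rewrite !mul0mx !mulmx0 !addr0 !add0r => /eq_block_mx[_ ur dl _].
  have ur0 : ursubmx h = 0 by rewrite -[LHS](mulmxK pBU) ur mul0mx.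
  have dl0 : dlsubmx h = 0 by rewrite -[LHS](mulKmx pBU') -dl mulmx0.
  have hE : h = block_diag (ulsubmx h) (drsubmx h).
    by rewrite /block_diag -{1}[h]submxK ur0 dl0.
  exists (ulsubmx h, drsubmx h) => //; apply/setXP; rewrite !inE /=; apply/andP.
  by rewrite -block_diag_mx_unit -[block_mx _ _ _ _]hE.
rewrite !inE /= => h1U h2U hE; exists (sim h1 A, sim h2 B).
  by apply/setXP; rewrite !powers_sim.
apply/eqP/simP => //; rewrite hE /f /= /block_diag !mulmx_block.
by rewrite !mul0mx !mulmx0 !addr0 !add0r /sim !mulmxKV.
Qed.

(** The cardinality of the action groupoid of the units on the [M]-th powers killed
    by [p]; it is this normalization that is multiplicative. *)
Definition power_mass p n : rat := #|powers p n|%:R / (gl F n)%:R.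

Lemma power_mass0 p : power_mass p 0 = 1.
Proof.
rewrite /power_mass (_ : powers p 0 = [set A | A \in unitmx]).
  by rewrite divff // pnatr_eq0 -lt0n gl_gt0.
apply/setP => x; rewrite [RHS]inE unitmxE det_mx00 unitr1; apply/powersP.
by split; [exact: mx0_eq | exists x; exact: mx0_eq].
Qed.

(** The blocks are told apart by the dimension [a] of the kernel of the value at
    [p], which is the rank of the value at [r]. *)
Lemma power_mass_coprime p r n : coprimep p r ->
  power_mass (p * r) n = \sum_(a < n.+1) power_mass p a * power_mass r (n - a).
Proof.
move=> cpr; rewrite /power_mass.
have -> : #|powers (p * r) n|
  = (\sum_(a < n.+1) #|[set x in powers (p * r) n | \rank (peval x r) == a]|)%N.
  pose rk (x : 'M_n) : 'I_n.+1 := inord (\rank (peval x r)).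
  rewrite -sum1_card (partition_big rk xpredT) //=.
  apply: eq_bigr => a _; rewrite -sum1dep_card; apply: eq_bigl => x.
  by rewrite -val_eqE /= inordK // ltnS rank_leq_row.
rewrite natr_sum mulr_suml; apply: eq_bigr => a _.
have an : (a <= n)%N by rewrite -ltnS.
have := card_coprime_block a (n - a) cpr; rewrite subnKC //.
move/(congr1 (fun m => m%:R : rat)).
rewrite !natrM => e.
have g0 m : (gl F m)%:R != 0 :> rat by rewrite pnatr_eq0 -lt0n gl_gt0.
rewrite -[X in X / _](mulfK (mulf_neq0 (g0 a) (g0 (n - a)%N))) e.
by field; rewrite !g0.
Qed.

End CoprimeDecomposition.

(** * Matrices as vector spaces over a residue field *)

Section LinearMatrix.
Variables (F : fieldType) (n p : nat) (f : 'rV[F]_n -> 'rV[F]_p).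

Definition mx_of_fun : 'M[F]_(n, p) := \matrix_i f (delta_mx 0 i).

Lemma mx_of_funE v : (forall a u w, f (a *: u + w) = a *: f u + f w) ->
  v *m mx_of_fun = f v.
Proof.
move=> f_lin.
have f0 : f 0 = 0 by have := f_lin (-1) 0 0; rewrite scaler0 addr0 scaleN1r addNr.
rewrite mulmx_sum_row {2}[v]row_sum_delta.
elim/big_rec2: _ => [|i x y _ ->]; first by rewrite f0.
by rewrite f_lin rowK.
Qed.

End LinearMatrix.

Section ResidueField.
Variables (F : finFieldType) (f : {poly F}).
Hypothesis fI : monic_irreducible_poly f.
Local Notation K := {poly %/ f with fI}.
Variable n' : nat.
Local Notation n := n'.+1.
Implicit Types (s : 'M[F]_n) (c : K).

(** The action of the residue field [F[X] / f] on row vectors through which a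
    matrix [s] with [f(s) = 0] acts as the class of the indeterminate. *)
Definition scalar_of s c : 'M[F]_n := horner_mx s (val (c : {poly %/ f})).

Lemma scalar_ofD s c e : scalar_of s (c + e) = scalar_of s c + scalar_of s e.
Proof. by rewrite /scalar_of rmorphD. Qed.

Lemma scalar_ofN s c : scalar_of s (- c) = - scalar_of s c.
Proof. by rewrite /scalar_of rmorphN. Qed.

Lemma horner_mx_rmod s (p : {poly F}) : peval s f = 0 ->
  horner_mx s (Pdiv.CommonRing.rmodp p (mk_monic f)) = horner_mx s p.
Proof.
rewrite (mk_monicE fI) peval_horner => sf.
rewrite {2}(Pdiv.RingMonic.rdivp_eq (snd fI) p) rmorphD rmorphM /= sf.
by rewrite mulr0 add0r.
Qed.

Lemma scalar_ofM s c e : peval s f = 0 ->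
  scalar_of s (c * e) = scalar_of s c *m scalar_of s e.
Proof.
move=> sf; rewrite /scalar_of [X in horner_mx s X = _]poly_of_qpolyM.
by rewrite horner_mx_rmod // rmorphM.
Qed.

Lemma scalar_of1 s : scalar_of s 1 = 1%:M.
Proof.
by rewrite /scalar_of -[RHS](rmorph1 (horner_mx s)); congr horner_mx.
Qed.

Lemma scalar_ofC s (a : F) : scalar_of s (a%:A) = a%:M.
Proof.
rewrite -scalemx1 -(scalar_of1 s) /scalar_of.
by rewrite [val _]poly_of_qpolyZ horner_mxZ.
Qed.

Lemma scalar_ofX s : peval s f = 0 -> scalar_of s 'qX = s.
Proof.
move=> sf; rewrite /scalar_of [val _]/(Pdiv.CommonRing.rmodp _ _).
by rewrite horner_mx_rmod // horner_mx_X.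
Qed.

Lemma scalar_of_comm s c (B : 'M_n) : s *m B = B *m s ->
  scalar_of s c *m B = B *m scalar_of s c.
Proof.
by move=> sB; rewrite /scalar_of -peval_horner (intertwine_peval _ (esym sB)).
Qed.

Lemma card_residue_field : #|{: K}| = (#|F| ^ deg f)%N.
Proof. exact: card_qfpoly. Qed.

(** The elements of the residue field are fixed by the Frobenius power
    [x |-> x ^ #|K|], and [s] is the action of one of them. *)
Lemma expmx_residue s i : peval s f = 0 -> s ^+ (#|F| ^ (deg f * i)) = s.
Proof.
move=> sf; have sX c j : scalar_of s c ^+ j = scalar_of s (c ^+ j).
  by elim: j => [|j IHj]; rewrite ?scalar_of1 // !exprS scalar_ofM // -IHj.
rewrite -{1 2}(scalar_ofX sf) sX; congr (scalar_of s _).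
rewrite expnM -card_residue_field.
by elim: i => [|i IHi]; rewrite ?expr1 // expnSr exprM IHi (expf_card (_ : K)).
Qed.

(** Linearity over the residue field, which acts on the target through [s]. *)
Definition semilinear s m (psi : 'rV[K]_m -> 'rV[F]_n) :=
  forall c u w, psi (c *: u + w) = psi u *m scalar_of s c + psi w.

Section SemilinearTheory.
Variables (s : 'M[F]_n) (m : nat) (psi : 'rV[K]_m -> 'rV[F]_n).
Hypotheses (psi_lin : semilinear s psi).

Lemma semilinear0 : psi 0 = 0.
Proof.
have := psi_lin (-1) 0 0; rewrite scaler0 addr0.
have := psi_lin 1 0 0; rewrite scaler0 addr0 scalar_of1 mulmx1.
by move/eqP; rewrite -subr_eq subrr => /eqP <-.
Qed.

Lemma semilinearZ c u : psi (c *: u) = psi u *m scalar_of s c.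
Proof. by rewrite -[c *: u]addr0 psi_lin semilinear0 addr0. Qed.

Lemma semilinear_inj : (forall u, psi u = 0 -> u = 0) -> injective psi.
Proof.
move=> ker0 u w uw; apply/eqP; rewrite -subr_eq0 -oppr_eq0 opprB addrC -scaleN1r.
apply/eqP/ker0; rewrite psi_lin uw -[X in _ + X]mulmx1 -mulmxDr.
rewrite -(scalar_of1 s) -scalar_ofD addNr /scalar_of.
by rewrite [val _]/(0 : {poly F}) rmorph0 mulmx0.
Qed.

Variable phi : 'rV[F]_n -> 'rV[K]_m.
Hypotheses (psiK : cancel psi phi) (phiK : cancel phi psi).

Lemma inv_semilinear c u w : phi (u *m scalar_of s c + w) = c *: phi u + phi w.
Proof. by apply: (can_inj psiK); rewrite phiK psi_lin !phiK. Qed.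

End SemilinearTheory.

(** As long as an injective map from [K^m] misses a vector, it extends to
    [K^(m + 1)] by mapping the new basis vector to a missed one. *)
Lemma semilinear_bij_or_inj s m : peval s f = 0 ->
    (exists l (psi : 'rV[K]_l -> 'rV[F]_n), semilinear s psi /\ bijective psi)
    \/ exists psi : 'rV[K]_m -> 'rV[F]_n, semilinear s psi /\ injective psi.
Proof.
move=> sf; elim: m => [|m [IHm | [psi [psi_lin psi_inj]]]]; [right | by left |].
    exists (fun _ => 0); split=> [c u w | u w _]; first by rewrite mul0mx addr0.
    by rewrite [u]thinmx0 [w]thinmx0.
  have [/forallP onto | ] := boolP [forall v, v \in codom psi].
    left; exists m, psi; split=> //; exists (fun v => iinv (onto v)) => v.
      by apply: psi_inj; rewrite f_iinv.
    by rewrite f_iinv.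
  rewrite negb_forall => /existsP[v vN]; right.
  pose psi' (u : 'rV[K]_m.+1) :=
    v *m scalar_of s (u 0 0) + psi (rsubmx (u : 'rV_(1 + m))).
  have psi'_lin : semilinear s psi'.
    move=> c u w; rewrite /psi' !mxE [rsubmx _]linearP psi_lin scalar_ofD mulrC.
    by rewrite scalar_ofM // mulmxDr mulmxDl -!mulmxA addrACA.
  exists psi'; split=> //; apply: (semilinear_inj psi'_lin) => u.
  rewrite /psi' => /eqP; rewrite addr_eq0 => /eqP e.
  have [u0 | u0] := eqVneq (u 0 0) 0.
    have sc0 : scalar_of s 0 = 0 by rewrite /scalar_of [val _]/(0 : {poly F}) rmorph0.
    have r0 : rsubmx (u : 'rV_(1 + m)) = 0.
      apply: psi_inj; rewrite (semilinear0 psi_lin); apply/eqP.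
      by rewrite -oppr_eq0 -e u0 sc0 mulmx0.
    rewrite -[u](@hsubmxK _ 1 1 m) r0 [lsubmx _]mx11_scalar mxE.
    by rewrite [lshift _ _](_ : _ = 0) ?u0 ?raddf0 ?row_mx0 //; apply: val_inj.
  case/negP: vN; apply/codomP; exists (- (u 0 0)^-1 *: rsubmx (u : 'rV_(1 + m))).
  rewrite (semilinearZ psi_lin) scalar_ofN mulmxN -mulNmx -e -mulmxA.
  by rewrite -scalar_ofM // mulfV // scalar_of1 mulmx1.
Qed.

(** Injections cannot exist in all dimensions for lack of vectors, so at some
    point one is bijective. *)
Lemma exists_semilinear s : peval s f = 0 ->
  exists m (psi : 'rV[K]_m -> 'rV[F]_n), semilinear s psi /\ bijective psi.
Proof.
move=> sf; have [//|[psi [_ /leq_card]]] := semilinear_bij_or_inj n.+1 sf.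
rewrite !card_mx card_residue_field !mul1n -expnM leq_exp2l ?finNzRing_gt1 //.
have [[+ _] _] := fI; rewrite /deg; case: (size f) => [|[|e]] // _.
by rewrite mulSn ltnNge leq_addr.
Qed.

Lemma mx_of_semilinear s t m (psi : 'rV[K]_m -> 'rV[F]_n)
    (theta : 'rV[K]_m -> 'rV[F]_n) phi :
    semilinear s psi -> semilinear t theta -> cancel psi phi -> cancel phi psi ->
  forall v, v *m mx_of_fun (theta \o phi) = theta (phi v).
Proof.
move=> psi_lin theta_lin psiK phiK v; rewrite mx_of_funE //= => a u w.
rewrite -[a *: u]mul_mx_scalar -(scalar_ofC s) (inv_semilinear psi_lin psiK phiK).
by rewrite theta_lin scalar_ofC mul_mx_scalar.
Qed.

(** Both [s] and [t] make the row vectors into a vector space over the residue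
    field, of the same dimension by cardinality; an isomorphism of these two
    spaces conjugates one matrix to the other. *)
Lemma residue_conj s t : peval s f = 0 -> peval t f = 0 ->
  exists2 g, g \in unitmx & sim g s = t.
Proof.
move=> sf tf.
have [m [psi [psi_lin [phi psiK phiK]]]] := exists_semilinear tf.
have [l [theta [theta_lin theta_bij]]] := exists_semilinear sf.
have lm : l = m.
  have cK : (1 < #|{: K}|)%N := finNzRing_gt1 _.
  have := bij_eq_card theta_bij; rewrite -(bij_eq_card (Bijective psiK phiK)) !card_mx.
  by rewrite !mul1n => /eqP; rewrite eqn_exp2l // => /eqP.
subst l; pose g := mx_of_fun (theta \o phi).
have gE v : v *m g = theta (phi v) := mx_of_semilinear psi_lin theta_lin psiK phiK v.
have gU : g \in unitmx.
  rewrite -row_free_unit; apply: inj_row_free => v vg; rewrite -[v]phiK.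
  rewrite (_ : phi v = 0) ?(semilinear0 psi_lin) //.
  by apply: (bij_inj theta_bij); rewrite -gE vg (semilinear0 theta_lin).
exists g => //; apply/eqP/simP => //; apply/row_matrixP => i.
rewrite !rowE !mulmxA !gE; set v := delta_mx 0 i.
rewrite -{1}(scalar_ofX sf) -(semilinearZ theta_lin); congr theta.
rewrite -[v *m t]addr0 -{1}(scalar_ofX tf) (inv_semilinear psi_lin psiK phiK).
rewrite [X in _ = _ + X](_ : _ = 0) ?addr0 //.
by apply: (can_inj psiK); rewrite phiK (semilinear0 psi_lin).
Qed.

End ResidueField.

(** * Powers killed by a power of an irreducible polynomial *)

Section Centralizer.
Variables (F : finFieldType) (f : {poly F}).
Hypothesis fI : monic_irreducible_poly f.
Local Notation K := {poly %/ f with fI}.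
Variables (n' m : nat).
Local Notation n := n'.+1.
Variables (s : 'M[F]_n) (psi : 'rV[K]_m -> 'rV[F]_n) (phi : 'rV[F]_n -> 'rV[K]_m).
Hypotheses (sf : peval s f = 0) (psi_lin : semilinear s psi).
Hypotheses (psiK : cancel psi phi) (phiK : cancel phi psi).

(** The isomorphism from the matrices over the residue field to the centralizer
    of [s]. *)
Definition embed (A : 'M[K]_m) : 'M[F]_n :=
  mx_of_fun (fun v => psi (phi v *m A)).

Lemma embedE A v : v *m embed A = psi (phi v *m A).
Proof.
rewrite mx_of_funE // => a u w.
rewrite -[a *: u]mul_mx_scalar -(scalar_ofC fI s) (inv_semilinear psi_lin psiK phiK).
by rewrite mulmxDl -scalemxAl psi_lin scalar_ofC mul_mx_scalar.
Qed.

Lemma mx_funP (A B : 'M[F]_n) : (forall v : 'rV_n, v *m A = v *m B) -> A = B.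
Proof. by move=> AB; apply/row_matrixP => i; rewrite !rowE. Qed.

Lemma embedM A B : embed (A *m B) = embed A *m embed B.
Proof. by apply: mx_funP => v; rewrite mulmxA !embedE psiK mulmxA. Qed.

Lemma embed1 : embed 1%:M = 1%:M.
Proof. by apply: mx_funP => v; rewrite embedE !mulmx1 phiK. Qed.

Lemma embedX A i : embed (A ^+ i) = embed A ^+ i.
Proof. by elim: i => [|i IHi]; rewrite ?embed1 // !exprS embedM IHi. Qed.

Lemma embed_inj : injective embed.
Proof.
move=> A B AB; apply/row_matrixP => i; rewrite !rowE.
by apply: (can_inj psiK); rewrite -[delta_mx _ _]psiK -!embedE AB.
Qed.

Lemma embed0 : embed 0 = 0.
Proof.
by apply: mx_funP => v; rewrite embedE !mulmx0 (semilinear0 psi_lin).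
Qed.

Lemma phi_mul_s v : phi (v *m s) = 'qX *: phi v.
Proof.
apply: (can_inj psiK); rewrite phiK (semilinearZ psi_lin).
by rewrite phiK (scalar_ofX fI sf).
Qed.

Lemma embed_comm A : embed A *m s = s *m embed A.
Proof.
apply: mx_funP => v; rewrite !mulmxA !embedE phi_mul_s -scalemxAl.
by rewrite (semilinearZ psi_lin) (scalar_ofX fI sf).
Qed.

(** What commutes with [s] commutes with all of its polynomials, that is, with
    the residue field. *)
Lemma embed_surj B : B *m s = s *m B -> exists A, B = embed A.
Proof.
move=> Bs; pose h (w : 'rV[K]_m) := phi (psi w *m B).
exists (mx_of_fun h); apply: mx_funP => v; rewrite embedE.
have -> : phi v *m mx_of_fun h = h (phi v).
  apply: mx_of_funE => c u w; rewrite /h psi_lin mulmxDl -mulmxA.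
  by rewrite scalar_of_comm // mulmxA (inv_semilinear psi_lin psiK phiK).
by rewrite /h !phiK.
Qed.

Lemma embed_unit A : (embed A \in unitmx) = (A \in unitmx).
Proof.
apply/idP/idP => AU.
  have [|B BE] := @embed_surj (invmx (embed A)).
    by rewrite -[LHS](mulmxK AU) -[_ *m s *m _]mulmxA -embed_comm mulKmx.
  have : A *m B = 1%:M by apply: embed_inj; rewrite embedM -BE mulmxV // embed1.
  by case/mulmx1_unit.
have : embed A *m embed (invmx A) = 1%:M by rewrite -embedM mulmxV // embed1.
by case/mulmx1_unit.
Qed.

Lemma embed_sim A B : A \in unitmx -> sim (embed A) (embed B) = embed (sim A B).
Proof.
move=> AU; apply/eqP/simP; first by rewrite embed_unit.
by rewrite -!embedM /sim mulmxKV.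
Qed.

End Centralizer.

Section PrimaryCount.
Variables (M k : nat) (F : finFieldType).
Hypotheses (M_prime : prime M) (k_gt0 : (0 < k)%N) (cardF : #|F| = (M ^ k)%N).
Local Notation q := #|F|.

Lemma pchar_mx n : M \in [pchar 'M[F]_n.+1].
Proof. by rewrite (pchar_lalg 'M[F]_n.+1) (pcharF M_prime cardF). Qed.

Lemma peval_block_root (f : {poly F}) m : f \is monic ->
  exists s : 'M[F]_(deg f * m), peval s f = 0.
Proof.
move=> f_monic; elim: m => [|m [s sf]].
  by rewrite muln0; exists 0; apply: mx0_eq.
rewrite mulnS; exists (block_diag (companionmx f) s); rewrite block_diag_peval sf.
rewrite (_ : peval _ _ = 0) /block_diag ?block_mx0 //.
have := companionmxK f_monic; move: (companionmx f); rewrite -/(deg f).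
case: (deg f) => [|d] A Af; first exact: mx0_eq.
by rewrite peval_horner -Af Cayley_Hamilton.
Qed.

Variable f : {poly F}.
Hypothesis fI : monic_irreducible_poly f.
Local Notation K := {poly %/ f with fI}.
Local Notation d := (deg f).
Variable L : nat.

Lemma deg_gt0 : (0 < d)%N.
Proof. by have [[+ _] _] := fI; rewrite /deg; case: (size f) => [|[|]]. Qed.

Let M_gt0 : (0 < M)%N := prime_gt0 M_prime.

(** The semisimple part of the Jordan decomposition of [x] is a power of [x]: a
    Frobenius power that is large enough to kill the nilpotent part, and that
    fixes the residue field. *)
Lemma peval_exp_root n (x : 'M[F]_n.+1) : peval x (f ^+ (q ^ L)) = 0 ->
  peval (x ^+ (q ^ (d * L))) f = 0.
Proof.
rewrite peval_exp => fx; rewrite -(peval_frobenius M_prime cardF).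
have le : (q ^ L <= q ^ (d * L))%N.
  by rewrite leq_exp2l ?finNzRing_gt1 // leq_pmull ?deg_gt0.
by rewrite -(subnK le) exprD fx mulr0.
Qed.

Lemma frobeniusD n (x y : 'M[F]_n.+1) i : x *m y = y *m x ->
  (x + y) ^+ (q ^ i) = x ^+ (q ^ i) + y ^+ (q ^ i).
Proof. by move=> xy; rewrite cardF -expnM (frobenius_comm _ (pchar_mx n)). Qed.

Lemma frobeniusB n (x y : 'M[F]_n.+1) i : x *m y = y *m x ->
  (x - y) ^+ (q ^ i) = x ^+ (q ^ i) - y ^+ (q ^ i).
Proof. by move=> xy; rewrite cardF -expnM (frobenius_comm_sub _ (pchar_mx n)). Qed.

(** With [s] a fixed root of [f] of the right size, a matrix killed by a power of
    [f] is conjugate to [s + A] for a nilpotent [A] in the centralizer of [s],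
    which is a matrix algebra over the residue field. As [s] is its own Frobenius
    power, it has an [M]-th root among its powers; so [s + A] is an [M]-th power
    if and only if [A] is one of a nilpotent matrix of the centralizer. And a
    unit that conjugates [s + A] to [s + B] conjugates their semisimple parts,
    hence commutes with [s]. *)
Lemma card_powers_primary n m : (n.+1 <= q ^ L)%N -> n.+1 = (d * m)%N ->
  (#|powers M (f ^+ (q ^ L)) n.+1| * gl K m = gl F n.+1 * #|nil_powers K M m|)%N.
Proof.
move=> nL ndm.
have [s sf] : exists s : 'M[F]_n.+1, peval s f = 0.
  by have := peval_block_root m (snd fI); rewrite -ndm.
have [l [psi [psi_lin [phi psiK phiK]]]] := exists_semilinear fI sf.
have lm : l = m.
  have := bij_eq_card (Bijective psiK phiK).
  rewrite !card_mx (card_residue_field fI) !mul1n -expnM ndm => /eqP.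
  by rewrite eqn_exp2l ?finNzRing_gt1 // eqn_pmul2l ?deg_gt0 // => /eqP.
subst l; pose emb := embed psi phi.
have sE i : s ^+ (q ^ (d * i)) = s := expmx_residue fI i sf.
pose Y := [set (s + emb A : 'M[F]_n.+1) | A in nil_powers K M m].
pose H := [set emb g | g in [set g : 'M[K]_m | g \in unitmx]].
have emb_inj : injective emb := embed_inj psi_lin psiK phiK.
have embX A i : emb (A ^+ i) = emb A ^+ i := embedX psi_lin psiK phiK A i.
have emb0 : emb 0 = 0 := embed0 psi_lin psiK phiK.
have embC A : emb A *m s = s *m emb A := embed_comm sf psi_lin psiK phiK A.
have mL : (m <= q ^ L)%N by apply: leq_trans nL; rewrite ndm leq_pmull // deg_gt0.
have nilL A i : (m <= i)%N -> A ^+ m = 0 -> emb A ^+ i = 0.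
  by move=> mi A0; rewrite -embX -(subnK mi) exprD A0 mulr0 emb0.
have LdL : (q ^ L <= q ^ (d * L))%N.
  by rewrite leq_exp2l ?finNzRing_gt1 // leq_pmull ?deg_gt0.
have ss A : A ^+ m = 0 -> (s + emb A) ^+ (q ^ (d * L)) = s.
  by move=> A0; rewrite frobeniusD ?embC // sE nilL ?addr0 // (leq_trans mL).
have -> : gl K m = #|H| by rewrite card_imset.
have -> : #|nil_powers K M m| = #|Y|.
  by rewrite card_imset // => A B /addrI/emb_inj.
apply: orbit_count => [h | g y gU /imsetP[A nA ->] | x | h y hU].
- by case/imsetP=> g; rewrite inE => gU ->; rewrite /emb (embed_unit sf psi_lin psiK phiK).
- apply: powers_sim => //; apply/powersP; split.
    rewrite peval_exp (peval_frobenius M_prime cardF) frobeniusD ?embC //.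
    rewrite nilL ?(nil_powers_nilpotent M_gt0 nA) // addr0.
    by rewrite -(peval_frobenius M_prime cardF) sf expr0n gtn_eqF // (leq_trans _ nL).
  move: nA; rewrite inE => /existsP[B /andP[_ /eqP ->]].
  have sM : (s ^+ (M ^ (k * d).-1)) ^+ M = s.
    rewrite -exprM -expnSr prednK ?muln_gt0 ?k_gt0 ?deg_gt0 //.
    by rewrite expnM -cardF -[d]muln1 sE.
  exists (s ^+ (M ^ (k * d).-1) + emb B).
  rewrite -[in RHS](expn1 M) (frobenius_comm _ (pchar_mx n)) ?expn1 ?sM ?embX //.
  by apply/commr_sym/commrX/embC.
- case/powersP=> fx [y xE]; set N := (q ^ (d * L))%N.
  (* The semisimple part of [x] is [x ^+ N]; that of its root [y] is [y ^+ N], and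
     [z] is the nilpotent part of [y]. *)
  have [g gU gs] := residue_conj fI (peval_exp_root fx) sf.
  pose z := y - y ^+ N.
  have yN : y *m y ^+ N = y ^+ N *m y by rewrite mulmxE -exprS exprSr.
  have zM : z ^+ M = x - x ^+ N.
    rewrite /z -(expn1 M) (frobenius_comm_sub _ (pchar_mx n)) ?expn1 //.
    by rewrite xE exprAC.
  have xN : x ^+ N ^+ N = x ^+ N.
    exact: (expmx_residue fI L (peval_exp_root fx)).
  have z0 : z ^+ (M * N) = 0.
    rewrite exprM zM frobeniusB; first by rewrite xN subrr.
    by rewrite mulmxE -exprS exprSr.
  have zs : z *m x ^+ N = x ^+ N *m z.
    rewrite xE -exprM /z mulmxBl mulmxBr !mulmxE -!exprD -exprS -exprSr.
    by rewrite addnC.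
  have [B BE] : exists B, sim g z = emb B.
        apply: (embed_surj psi_lin psiK phiK).
    by rewrite -gs /sim !mulmxA !mulmxKV // -!(mulmxA g) zs.
  have B0 : B ^+ m = 0.
    apply: (@nilpotent_expmx _ _ (M * N)); apply: emb_inj.
    by rewrite embX -BE -simX // z0 emb0 /sim mulmx0 mul0mx.
  exists g => //; apply/imsetP; exists (B ^+ M).
    by rewrite inE; apply/existsP; exists B; rewrite B0 !eqxx.
  rewrite embX -BE -simX // zM -gs /sim -mulmxDl -mulmxDr.
  by rewrite [_ + (x - _)]addrC subrK.
case/imsetP=> A nA ->.
apply/imsetP/imsetP => [[B nB hB] | [g]].
  have hs : h *m s = s *m h.
    rewrite -{1}(ss _ (nil_powers_nilpotent M_gt0 nA))
      -{2}(ss _ (nil_powers_nilpotent M_gt0 nB)).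
    by apply/intertwine_exp/(simP _ _ hU)/eqP.
  have [g gE] := embed_surj psi_lin psiK phiK hs.
  exists g => //; rewrite inE -(embed_unit sf psi_lin psiK phiK).
  by rewrite -gE.
rewrite inE => gU hE; exists (sim g A); first exact: nil_powers_sim.
rewrite /emb -(embed_sim sf psi_lin psiK phiK) //.
apply/eqP/simP => //; rewrite mulmxDr mulmxDl hE embC; congr (_ + _).
by rewrite /sim mulmxKV // (embed_unit sf psi_lin psiK phiK).
Qed.

(** The semisimple part turns the row vectors into a vector space over the residue
    field, whence the condition on their number. *)
Lemma powers_primary_dvd n : powers M (f ^+ (q ^ L)) n.+1 != set0 -> (d %| n.+1)%N.
Proof.
case/set0Pn=> x /powersP[/peval_exp_root sf _].
have [m [psi [_ psi_bij]]] := exists_semilinear fI sf.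
have := bij_eq_card psi_bij.
rewrite !card_mx (card_residue_field fI) !mul1n -expnM => /eqP.
by rewrite eqn_exp2l ?finNzRing_gt1 // => /eqP <-; apply: dvdn_mulr.
Qed.

Lemma power_mass_primary n : (n <= q ^ L)%N ->
  power_mass M (f ^+ (q ^ L)) n = local_factor M q d n.
Proof.
case: n => [|n] nL.
  by rewrite power_mass0 /local_factor big_geq // addr0.
rewrite /local_factor /fps_one /= add0r.
have g0 (E : finFieldType) r : (gl E r)%:R != 0 :> rat by rewrite pnatr_eq0 -lt0n gl_gt0.
have [dn | ndn] := boolP (d %| n.+1)%N.
  have ndm : n.+1 = (d * (n.+1 %/ d))%N by rewrite mulnC divnK.
  move: (n.+1 %/ d)%N ndm => m ndm.
  have mn : m \in index_iota 1 n.+2 by rewrite mem_index_iota; have := deg_gt0; nia.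
  rewrite big_mkcond (bigD1_seq m mn (iota_uniq _ _)) /=.
  rewrite mulnC -ndm eqxx [X in _ + X]big1 ?addr0 => [|i im]; last first.
    rewrite ndm mulnC eqn_pmul2l ?deg_gt0 //; by rewrite (negPf im).
  rewrite -(card_nil_powers M_gt0 _ (card_residue_field fI)) /power_mass.
  have := card_powers_primary nL ndm => /(congr1 (fun i => i%:R : rat)).
  by rewrite !natrM => e; apply/eqP; rewrite eqr_div // e mulrC.
rewrite big1_seq => [|i /andP[/eqP e _]]; last by rewrite -e dvdn_mull in ndn.
rewrite /power_mass (_ : powers _ _ _ = set0) ?cards0 ?mul0r //.
by apply: contraNeq ndn; apply: powers_primary_dvd.
Qed.

End PrimaryCount.

(** * The product over all irreducible polynomials *)

Section IrreducibleFactors.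
Variable F : finFieldType.
Implicit Types (f g p : {poly F}).

Lemma monic_irreducible_factor p : (1 < size p)%N ->
  exists h, [/\ h \is monic, irreducible_poly h & h %| p].
Proof.
have [m] := ubnP (size p); elim: m p => // m IHm p pm p1.
have [/irreducibleP pI | ] := boolP (irreducibleb p).
  have p0 : p != 0 by rewrite -size_poly_gt0 ltnW.
  have cp : (lead_coef p)^-1 != 0 by rewrite invr_eq0 lead_coef_eq0.
  exists ((lead_coef p)^-1 *: p); split.
  - by rewrite monicE lead_coefZ mulVf // lead_coef_eq0.
  - split=> [|r r1 rp]; first by rewrite size_scale.
    have rp' : r %| p by rewrite dvdpZr in rp.
    by apply: eqp_trans ((snd pI) r r1 rp') _; rewrite eqp_sym eqp_scale.
  - by rewrite dvdpZl.
rewrite /irreducibleb p1 /= negb_forall => /existsP[r].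
rewrite negb_imply -ltnNge => /andP[rp r1].
have rm : (size (r : {poly F}) < m)%N.
  rewrite -ltnS; apply: leq_trans pm; rewrite ltnS.
  by apply: leq_ltn_trans (size_npoly r) _; rewrite prednK // ltnW.
have [h [h1 h2 hr]] := IHm _ rm r1.
by exists h; split=> //; rewrite (dvdp_trans hr) // dvdpE.
Qed.

Lemma Phi_coprime f g : Phi f -> Phi g -> f != g -> coprimep f g.
Proof.
move=> [fm fI _] [gm gI _] fg; rewrite irreducible_poly_coprime //.
apply: contra fg => fdg; rewrite -eqp_monic //.
by apply: (snd gI) => //; rewrite gtn_eqF // (fst fI).
Qed.

(** All irreducible factors of [p] are in [s], and their number with multiplicity
    is at most the degree of [p]. *)
Lemma dvdp_Phi_prod n (s : seq {poly F}) p :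
    (forall f, Phi f -> (size f <= n.+1)%N -> f \in s) ->
    p`_0 != 0 -> (size p <= n.+1)%N ->
  p %| (\prod_(f <- s) f) ^+ (size p).-1.
Proof.
move=> sP; have [m] := ubnP (size p); elim: m p => // m IHm p pm p00 pn.
have p0 : p != 0 by apply: contraNneq p00 => ->; rewrite coef0.
have [p1 | p1] := leqP (size p) 1.
  rewrite (_ : (size p).-1 = 0)%N ?expr0; last by case: (size p) p1 => [|[]].
  by rewrite dvdp1 eqn_leq p1 size_poly_gt0.
have [h [hm hI /dvdpP[r pE]]] := monic_irreducible_factor p1.
move: p0; rewrite pE mulf_eq0 negb_or => /andP[r0 h0].
move: p00; rewrite pE coef0M mulf_eq0 negb_or => /andP[r00 h00].
have h1 : (1 < size h)%N := fst hI.
have szE : size p = (size r + (size h).-1)%N.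
  by rewrite pE size_mul //; case: (size h) h1 => // e _; rewrite addnS.
have r_gt0 : (0 < size r)%N by rewrite size_poly_gt0.
have hs : h \in s.
  apply: sP; last by rewrite -[size h](ltn_predK h1); lia.
  by split=> //; apply: contraNneq h00 => ->; rewrite coefX.
have -> : (size (r * h)).-1 = ((size r).-1 + (size h).-2.+1)%N by rewrite -pE szE; lia.
rewrite exprD; apply: dvdp_mul.
  have rp : (size r < size p)%N.
    by rewrite szE -[X in (X < _)%N]addn0 ltn_add2l -subn1 subn_gt0.
  apply: IHm => //; first exact: leq_trans rp pm.
  exact: leq_trans (ltnW rp) pn.
rewrite exprS dvdp_mulr // (perm_big _ (perm_to_rem hs)) big_cons.
exact: dvdp_mulr.
Qed.

End IrreducibleFactors.

Section Assembly.
Variables (M k : nat) (F : finFieldType).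
Hypotheses (M_prime : prime M) (k_gt0 : (0 < k)%N) (cardF : #|F| = (M ^ k)%N).
Local Notation q := #|F|.

Lemma power_mass1 n : power_mass M (1 : {poly F}) n = fps_one n.
Proof.
case: n => [|n]; first exact: power_mass0.
rewrite /power_mass /fps_one /=.
rewrite (_ : powers _ _ _ = set0) ?cards0 ?mul0r //.
apply/setP => x; rewrite [RHS]inE; apply/negbTE/negP => /powersP[].
by rewrite peval1 => one0 _; have := matrix_nonzero1 F n; rewrite one0 eqxx.
Qed.

(** The exponent must be the same for all coefficients up to [n], for the
    product formula, and is a power of [q] large enough for the largest of
    them. *)
Lemma power_mass_prod n (s : seq {poly F}) : uniq s -> (forall f, f \in s -> Phi f) ->
  forall j, (j <= n)%N ->
  (\big[fps_mul/fps_one]_(f <- s) local_factor M q (deg f)) j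
  = power_mass M ((\prod_(f <- s) f) ^+ (q ^ n)) j.
Proof.
elim: s => [|f s IHs] /= => [_ _ j _|/andP[fs us] sP j jn].
  by rewrite !big_nil expr1n power_mass1.
have fP : Phi f by apply: sP; rewrite inE eqxx.
have sP' g : g \in s -> Phi g by move=> gs; apply: sP; rewrite inE gs orbT.
rewrite !big_cons exprMn power_mass_coprime; last first.
  apply/coprimep_expl/coprimep_expr; rewrite big_seq.
  elim/big_rec: _ => [|g p gs fp]; first exact: coprimep1.
  rewrite coprimepMr fp andbT; apply: Phi_coprime fP (sP' _ gs) _.
  by apply: contraNneq fs => ->.
apply: eq_bigr => a _; have aj : (a <= j)%N by rewrite -ltnS.
have nq : (n <= q ^ n)%N by rewrite ltnW // ltn_expl // finNzRing_gt1.
have [fm fI _] := fP.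
rewrite (power_mass_primary M_prime k_gt0 cardF (f := f) (fI, fm)); last first.
  exact: leq_trans aj (leq_trans jn nq).
by rewrite IHs // (leq_trans (leq_subr _ _)).
Qed.

(** The product is coprime to ['X], so what it kills is invertible; conversely, the
    characteristic polynomial of an invertible matrix divides it. *)
Lemma powers_GL n (s : seq {poly F}) :
    (forall f, Phi f -> (size f <= n.+2)%N -> f \in s) -> (forall f, f \in s -> Phi f) ->
  powers M ((\prod_(f <- s) f) ^+ (q ^ n.+1)) n.+1
  = [set val u | u in GL_powers F n.+1 M].
Proof.
move=> sP Ps; apply/setP => x; apply/powersP/imsetP => [[Px [y xE]] | [u]].
  have cop : coprimep 'X ((\prod_(f <- s) f) ^+ (q ^ n.+1)).
    apply: coprimep_expr; rewrite big_seq; elim/big_rec: _ => [|f p /Ps fP Xp].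
      exact: coprimep1.
    rewrite coprimepMr Xp andbT coprimep_sym irreducible_poly_coprime; last by case: fP.
    have [fm fI fX] := fP; apply: contra fX => fdX.
    rewrite -eqp_monic ?monicX // -dvdp_size_eqp // size_polyX eqn_leq.
    by rewrite (fst fI) andbT -(size_polyX F) dvdp_leq ?polyX_eq0.
  have xU : x \in unitmx.
    by rewrite -[x]pevalX; rewrite coprimep_sym in cop; apply: peval_unit cop Px.
  have yU : y \in unitmx.
    move: xU; rewrite xE -(prednK (prime_gt0 M_prime)) exprS -mulmxE unitmx_mul.
    by case/andP.
  pose v : {'GL_n.+1[F]} := FinRing.unit _ yU.
  exists (v ^+ M)%g; last by rewrite FinRing.val_unitX.
  by apply/imsetP; exists v; rewrite ?inE.
case/imsetP=> v _ -> ->; rewrite FinRing.val_unitX; split; last by exists (val v).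
set A : 'M[F]_n.+1 := _ ^+ M.
have AU : A \in unitmx.
  have expU i : (val v : 'M[F]_n.+1) ^+ i \in unitmx; last exact: expU.
  elim: i => [|i IHi]; first by rewrite expr0 unitmx1.
  by rewrite exprS -mulmxE unitmx_mul IHi (valP v).
have : char_poly A %| (\prod_(f <- s) f) ^+ (q ^ n.+1).
  have c0 : (char_poly A)`_0 != 0.
    rewrite char_poly_det mulf_neq0 ?expf_neq0 ?oppr_eq0 ?oner_eq0 //.
    by rewrite -unitfE -unitmxE.
  apply: dvdp_trans (dvdp_Phi_prod sP c0 _) _; first by rewrite size_char_poly.
  rewrite size_char_poly /=.
  have nq : (n.+1 <= q ^ n.+1)%N by rewrite ltnW // ltn_expl // finNzRing_gt1.
  exact: dvdp_exp2l.
case/dvdpP => r ->; rewrite pevalM [X in _ *m X]peval_horner Cayley_Hamilton.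
exact: mulmx0.
Qed.

Lemma power_mass_GL n (s : seq {poly F}) :
    (forall f, Phi f -> (size f <= n.+1)%N -> f \in s) -> (forall f, f \in s -> Phi f) ->
  power_mass M ((\prod_(f <- s) f) ^+ (q ^ n)) n = GL_power_series F M n.
Proof.
case: n => [|n] sP Ps; first by rewrite power_mass0.
rewrite /power_mass powers_GL // /GL_power_series /=.
rewrite card_imset; last exact: val_inj.
congr (_ / _%:R); rewrite -(card_imset 'GL_n.+1[F]%g val_inj).
apply: eq_card => A; rewrite inE; apply/idP/imsetP => [AU | [u _ ->]].
  by exists (FinRing.unit _ AU); rewrite ?inE.
exact: (valP u).
Qed.

End Assembly.

Theorem proposition10p9 (M k q : nat) (F : finFieldType)
    (hM : prime M) (hk : (0 < k)%N) (hq : q = (M ^ k)%N) (hF : #|F| = q) :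
  is_fps_prod (@Phi F) (fun f : {poly F} => local_factor M q (deg f))
    (GL_power_series F M).
Proof.
have cardF : #|F| = (M ^ k)%N by rewrite hF.
move=> n; pose irr (f : {poly F}) := [&& f \is monic, irreducibleb f & f != 'X].
have irrP f : reflect (Phi f) (irr f).
  apply: (iffP and3P) => [[fm /irreducibleP fI fX] | [fm fI fX]]; first by split.
  by split=> //; apply/irreducibleP.
(* Only polynomials of degree at most [n] matter for the coefficient of index
   [n]. *)
exists [seq f <- [seq val p | p : {poly_n.+1 F}] | irr f] => [f | s us sP s0s].
  by rewrite mem_filter => /andP[/irrP].
rewrite -hF (power_mass_prod hM hk cardF us sP (leqnn n)).
apply: power_mass_GL => // f fP fn; apply: s0s; rewrite mem_filter.
apply/andP; split; first exact/irrP.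
by apply/imageP; exists (npolyp n.+1 f) => //; apply/esym/npolypK.
Qed.
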